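(* Let $\Gamma$ be an LR-tableau with entries at most $2$, and let $(\alpha,\beta,\gamma)$ be partitions with $\alpha_1\le2$. (1) The poset $(\mathcal K(\Gamma),\leq_{\rm arc})$ has exactly one minimal element, namely the dominant Klein tableau refining $\Gamma$. (2) The poset $(\mathcal K(\Gamma),\leq_{\rm arc})$ has exactly one maximal element. (3) The poset $(\mathcal K(\alpha,\beta,\gamma),\leq_{\rm arc})$ has exactly one maximal element. (4) The set of minimal elements of $(\mathcal K(\alpha,\beta,\gamma),\leq_{\rm arc})$ consists of the minimal elements of the posets $\mathcal K(\Gamma_1),\ldots,\mathcal K(\Gamma_s)$, where $\Gamma_1,\ldots,\Gamma_s$ are all the LR-tableaux of type $(\alpha,\beta,\gamma)$.
   Context: Young diagram conventions: a partition $\lambda$ has columns of lengths $\lambda_1,\lambda_2,\ldots$, rows numbered from the top; $\bar\lambda$ is the conjugate partition. An LR-tableau of type $(\alpha,\beta,\gamma)$ with entries at most $2$ is a filling of the skew diagram $\beta\setminus\gamma$ with $\bar\alpha_1$ entries $1$ and $\bar\alpha_2$ entries $2$, weakly increasing along rows, strictly increasing down columns, such that for each $c\ge0$ the number of $2$'s in columns to the right of column $c$ is at most the number of $1$'s there. A Klein tableau is such a tableau where each entry $2$ carries a subscript $r$ ($2_r$) with: (a) $1\le r\le m-1$ if it lies in row $m$; (b) $r=m-1$ if the box above it contains $1$; (c) the number of $2_r$'s is at most the number of $1$'s in row $r$. It refines the LR-tableau obtained by removing subscripts. The dominant Klein tableau refining $\Gamma$ is obtained by going through the entries $2$ of $\Gamma$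 row by row from the top and assigning to each the largest available subscript. $\mathcal K(\Gamma)$ is the set of Klein tableaux refining $\Gamma$ and $\mathcal K(\alpha,\beta,\gamma)$ the set of all Klein tableaux of type $(\alpha,\beta,\gamma)$. Arc diagram of a Klein tableau: an arc $(m,r)$ for each $2_r$ in row $m$, and at each position $r$ as many poles as the number of $1$'s in row $r$ minus the number of arcs ending at $r$; a Klein tableau of given type is determined by its arc diagram. Moves: for $m>n>r>s$, (A) replaces arcs $(m,r),(n,s)$ by $(m,s),(n,r)$; (C) replaces arcs $(m,r),(n,s)$ by $(m,n),(r,s)$; for $m>r>s$, (B) replaces arc $(m,s)$ and pole at $r$ by arc $(m,r)$ and pole at $s$; (D) replaces arc $(m,s)$ and pole at $r$ by pole at $m$ and arc $(r,s)$. For Klein tableaux $\Pi,\Pi'$ of the same type, $\Pi\leq_{\rm arc}\Pi'$ if the arc diagram of $\Pi$ is obtained from that of $\Pi'$ by a finite (possibly empty) sequence of moves; this is a partial order.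
   Formalization: Klein tableaux with the same arc diagram are identified, so ''exactly one'' means up to equality of arc diagrams (conditions (a)-(c) alone do not make the tableau unique), and (3) assumes that some LR-tableau of type (α,β,γ) exists, as an empty poset has no maximal element. *)

(* Defs.v *)
From mathcomp Require Import all_boot.
Set Implicit Arguments.
Unset Strict Implicit.
Unset Printing Implicit Defensive.

(* A partition lambda is a seq nat of COLUMN lengths lambda_1 >= lambda_2  *)
(* >= ... > 0.  Columns are indexed from 0 (column c has length            *)
(* nth 0 lambda c), rows are indexed from 1 (row 1 is the top row).        *)
(* The box (r, c) lies in lambda iff 1 <= r <= nth 0 lambda c.             *)

Definition is_partition (l : seq nat) : bool :=
  sorted geq l && all (fun x => 0 < x) l.

Definition conj (l : seq nat) (r : nat) : nat := count (fun x => r <= x) l.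

Definition in_skew (beta gamma : seq nat) (r c : nat) : bool :=
  (nth 0 gamma c < r) && (r <= nth 0 beta c).

(* Bounds of the region containing beta: rows 0..H, columns 0..N-1. *)
Definition bH (beta : seq nat) : nat := nth 0 beta 0.
Definition bN (beta : seq nat) : nat := size beta.

(* A filling is a function (row, column) -> entry, with entry 0 meaning    *)
(* "no box".                                                                *)
Definition filling := nat -> nat -> nat.

Definition tcount (beta : seq nat) (T : filling) (k : nat) : nat :=
  \sum_(r < (bH beta).+1) \sum_(c < bN beta) ((T r c == k) : nat).

Definition rcount (beta : seq nat) (T : filling) (k r : nat) : nat :=
  \sum_(c < bN beta) ((T r c == k) : nat).

(* number of entries k in the columns with (0-based) index >= c0, i.e. in  *)
(* the columns to the right of (1-based) column c0                          *)
Definition ccount_from (beta : seq nat) (T : filling) (k c0 : nat) : nat :=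
  \sum_(c0 <= c < bN beta) \sum_(r < (bH beta).+1) ((T r c == k) : nat).

Definition is_LR (alpha beta gamma : seq nat) (T : filling) : Prop :=
  [/\ (forall r c, ~~ in_skew beta gamma r c -> T r c = 0),
      (forall r c, in_skew beta gamma r c -> T r c = 1 \/ T r c = 2),
      tcount beta T 1 = conj alpha 1 /\ tcount beta T 2 = conj alpha 2,
      (forall r c, in_skew beta gamma r c -> in_skew beta gamma r c.+1 ->
          T r c <= T r c.+1)
    & (forall r c, in_skew beta gamma r c -> in_skew beta gamma r.+1 c ->
          T r c < T r.+1 c)
      /\ (forall c0, ccount_from beta T 2 c0 <= ccount_from beta T 1 c0)].

(* A Klein filling: K r c = (entry, subscript); (0,0) outside the skew     *)
(* diagram, (1,0) for an entry 1 and (2,s) for an entry 2_s.                *)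
Definition kfilling := nat -> nat -> (nat * nat).

Definition kunder (K : kfilling) : filling := fun r c => (K r c).1.

Definition count2s (beta : seq nat) (K : kfilling) (s : nat) : nat :=
  \sum_(m < (bH beta).+1) \sum_(c < bN beta) ((K m c == (2, s)) : nat).

Definition is_klein (alpha beta gamma : seq nat) (K : kfilling) : Prop :=
  [/\ is_LR alpha beta gamma (kunder K),
      (forall r c, (K r c).1 != 2 -> (K r c).2 = 0),
      (forall m c, (K m c).1 = 2 -> 1 <= (K m c).2 <= m.-1),
      (forall m c, (K m c).1 = 2 -> (K m.-1 c).1 = 1 -> (K m c).2 = m.-1)
    &
      (forall s, count2s beta K s <= rcount beta (kunder K) 1 s)].

Definition klein_of (alpha beta gamma : seq nat) (G : filling) (K : kfilling)
  : Prop :=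
  is_klein alpha beta gamma K /\ (forall r c, (K r c).1 = G r c).

(* Arc diagrams: arcs m r = number of arcs (m, r); poles r = number of     *)
(* poles at position r.                                                     *)
Definition arcdiag := ((nat -> nat -> nat) * (nat -> nat))%type.

Definition kdiag (beta : seq nat) (K : kfilling) : arcdiag :=
  (fun m r => \sum_(c < bN beta) ((K m c == (2, r)) : nat),
   fun r => rcount beta (kunder K) 1 r - count2s beta K r).

Definition diag_eq (D D' : arcdiag) : Prop :=
  (forall m r, D.1 m r = D'.1 m r) /\ (forall r, D.2 r = D'.2 r).

Definition ind2 (x y m r : nat) : nat := ((x == m) && (y == r) : bool).
Definition ind1 (y r : nat) : nat := ((y == r) : bool).

Definition arc_move (D D' : arcdiag) : Prop :=
  (* (A) m>n>r>s : (m,r),(n,s) ~> (m,s),(n,r) *)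
  (exists m n r s, [/\ s < r, r < n, n < m,
     (forall x y, D'.1 x y + ind2 x y m r + ind2 x y n s
                  = D.1 x y + ind2 x y m s + ind2 x y n r)
   & forall y, D'.2 y = D.2 y]) \/
  (* (C) m>n>r>s : (m,r),(n,s) ~> (m,n),(r,s) *)
  (exists m n r s, [/\ s < r, r < n, n < m,
     (forall x y, D'.1 x y + ind2 x y m r + ind2 x y n s
                  = D.1 x y + ind2 x y m n + ind2 x y r s)
   & forall y, D'.2 y = D.2 y]) \/
  (* (B) m>r>s : arc (m,s), pole r ~> arc (m,r), pole s *)
  (exists m r s, [/\ s < r, r < m,
     (forall x y, D'.1 x y + ind2 x y m s = D.1 x y + ind2 x y m r)
   & forall y, D'.2 y + ind1 y r = D.2 y + ind1 y s]) \/
  (* (D) m>r>s : arc (m,s), pole r ~> pole m, arc (r,s) *)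
  (exists m r s, [/\ s < r, r < m,
     (forall x y, D'.1 x y + ind2 x y m s = D.1 x y + ind2 x y r s)
   & forall y, D'.2 y + ind1 y r = D.2 y + ind1 y m]).

Inductive arc_reach : arcdiag -> arcdiag -> Prop :=
| arc_reach_refl D D' : diag_eq D D' -> arc_reach D D'
| arc_reach_step D D1 D' : arc_move D D1 -> arc_reach D1 D' -> arc_reach D D'.

Definition arc_le (beta : seq nat) (P P' : kfilling) : Prop :=
  arc_reach (kdiag beta P') (kdiag beta P).

(* Klein tableaux are identified when their arc diagrams agree. *)
Definition minimal_in (beta : seq nat) (S : kfilling -> Prop) (P : kfilling)
  : Prop :=
  S P /\ forall P', S P' -> arc_le beta P' P -> diag_eq (kdiag beta P') (kdiag beta P).

Definition maximal_in (beta : seq nat) (S : kfilling -> Prop) (P : kfilling)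
  : Prop :=
  S P /\ forall P', S P' -> arc_le beta P P' -> diag_eq (kdiag beta P') (kdiag beta P).

Definition unique_maximal (beta : seq nat) (S : kfilling -> Prop) : Prop :=
  exists P, maximal_in beta S P /\
    forall P', maximal_in beta S P' -> diag_eq (kdiag beta P') (kdiag beta P).

(* The dominant Klein tableau refining G: the entries 2 are processed row   *)
(* by row from the top (left to right inside a row) and each gets the       *)
(* largest subscript still available, i.e. the largest subscript for which  *)
(* the assignment made so far extends to a Klein tableau refining G.        *)
Definition is_dominant (alpha beta gamma : seq nat) (G : filling)
  (D : kfilling) : Prop :=
  klein_of alpha beta gamma G D /\
  forall r c, G r c = 2 ->
    forall K, klein_of alpha beta gamma G K ->
      (forall r' c', (r' < r) || ((r' == r) && (c' < c)) -> K r' c' = D r' c') ->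
      (K r c).2 <= (D r c).2.

(* Main.v *)
Require Import Defs.
From mathcomp Require Import all_boot zify.
From Stdlib Require Import Classical FunctionalExtensionality.

(* Removing the arcs (m, m-1) that are forced by boxes 2 below boxes 1, a Klein
   tableau of type (alpha, beta, gamma) is the same as an arc diagram whose
   number of boxes per row and number of arcs are prescribed; the lattice
   condition is then automatic, and its rows 1...12...2 are determined by the
   diagram.

   Every move strictly decreases the sum of f(m - r) over all arcs (m, r), for a
   strictly increasing and strictly concave f. Hence a tableau is minimal as soon
   as no move applies to it, and maximal elements exist. Each of the moves (C)
   and (D) applies exactly when (A), respectively (B), applies, so that minimality
   in K(Gamma) and in K(alpha, beta, gamma) both mean that the diagram has no
   crossings; such a diagram is unique for given row contents, by induction on
   the length of arcs. If a dominant tableau had a crossing, the move resolving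
   it could be performed by relabelling boxes and would increase the label of
   the first of them.

   Dually, in a maximal element of K(Gamma) the free arcs match the entries 2
   with the topmost entries 1 first-in first-out, and in a maximal element of
   K(alpha, beta, gamma) all left ends of free arcs precede all poles, which
   precede all right ends; both patterns are determined by the row data. *)

(** * Finite sums *)

Lemma ltn_sum_ex n (f g : nat -> nat) :
  \sum_(i < n) f i < \sum_(i < n) g i -> exists2 i, i < n & f i < g i.
Proof.
move=> lt_fg; case: (boolP [exists i : 'I_n, f i < g i]) => [/existsP[i ?]|].
  by exists i.
rewrite negb_exists => /forallP ge_fg; suff: false by [].
move: lt_fg; apply: contraTT => _; rewrite -leqNgt; apply: leq_sum => i _.
by rewrite leqNgt ge_fg.
Qed.

Lemma ltn_sum_at n (f g : nat -> nat) r :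
  r < n -> (forall i, i < n -> f i <= g i) -> f r < g r ->
  \sum_(i < n) f i < \sum_(i < n) g i.
Proof.
move=> ltrn le_fg lt_r; rewrite (bigD1 (Ordinal ltrn)) //=.
rewrite [X in _ < X](bigD1 (Ordinal ltrn)) //=.
rewrite -addSn; apply: leq_add; first exact: lt_r.
by apply: leq_sum => i _; apply: le_fg.
Qed.

Lemma eq_sum_gt_ex n (f g : nat -> nat) r :
  \sum_(i < n) f i = \sum_(i < n) g i -> r < n -> g r < f r ->
  exists2 s, s < n & f s < g s.
Proof.
move=> eq_fg ltrn lt_r.
case: (boolP [exists i : 'I_n, f i < g i]) => [/existsP[i ?]|]; first by exists i.
rewrite negb_exists => /forallP ge_fg.
suff: \sum_(i < n) g i < \sum_(i < n) f i by rewrite eq_fg ltnn.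
apply: (ltn_sum_at _ _ _ _ ltrn) => // i lt_i.
by rewrite leqNgt (ge_fg (Ordinal lt_i)).
Qed.

(** Here [x] is the first index where the functions disagree; equal sums force a disagreement of
    opposite sign, which must come later. *)
Lemma eq_sum_diff n (f g : nat -> nat) :
  \sum_(i < n) f i = \sum_(i < n) g i -> (exists2 i, i < n & f i <> g i) ->
  exists x z, [/\ x < z, z < n &
    (g x < f x /\ f z < g z) \/ (f x < g x /\ g z < f z)].
Proof.
move=> eq_fg [i0 lt_i0 ne0].
have ex_d : exists i, (i < n) && (f i != g i) by exists i0; apply/andP; split=> //; apply/eqP.
case: (ex_minnP ex_d) => x /andP[ltxn ne_x] min_x.
have agree z : z < n -> f z <> g z -> z <> x -> x < z.
  move=> ltz /eqP ne_z /eqP ne_zx; rewrite ltn_neqAle eq_sym ne_zx /=.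
  by apply: min_x; rewrite ltz.
have [lt_x|lt_x|eq_x] := ltngtP (f x) (g x); last by rewrite eq_x eqxx in ne_x.
  have [z ltz lt_z] := eq_sum_gt_ex _ _ _ _ (esym eq_fg) ltxn lt_x.
  exists x, z; split=> //; last by right.
  by apply: agree => // [|e]; [|subst z]; lia.
have [z ltz lt_z] := eq_sum_gt_ex _ _ _ _ eq_fg ltxn lt_x.
exists x, z; split=> //; last by left.
by apply: agree => // [|e]; [|subst z]; lia.
Qed.

Lemma sum_ord_eq n i : \sum_(j < n) (val j == i : nat) = (i < n).
Proof.
elim: n => [|n IHn]; first by rewrite big_ord0.
by rewrite big_ord_recr IHn /=; lia.
Qed.

Lemma sum_ind2_row n x m r :
  r < n -> \sum_(y < n) ind2 x y m r = (x == m).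
Proof.
move=> ltrn; have := sum_ord_eq n r; rewrite ltrn => one.
rewrite -[RHS]muln1 -[X in _ = _ * X]/(nat_of_bool true) -one.
by rewrite big_distrr /=; apply: eq_bigr => y _; rewrite mulnb.
Qed.

Lemma sum_ind2_col n y m r :
  m < n -> \sum_(x < n) ind2 x y m r = (y == r).
Proof.
move=> ltmn; have := sum_ord_eq n m; rewrite ltmn => one.
rewrite -[RHS]mul1n -[X in _ = X * _]/(nat_of_bool true) -one.
by rewrite big_distrl /=; apply: eq_bigr => x _; rewrite mulnb.
Qed.

Lemma sum2_ind2 n1 n2 (F : nat -> nat -> nat) m r : m < n1 -> r < n2 ->
  \sum_(x < n1) \sum_(y < n2) ind2 x y m r * F x y = F m r.
Proof.
move=> ltm ltr; transitivity (\sum_(x < n1) (val x == m : nat) * F m r).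
  apply: eq_bigr => x _; rewrite -(sum_ind2_row n2 x m r) // big_distrl /=.
  by apply: eq_bigr => y _; rewrite /ind2; do 2![case: eqP => // ->].
by rewrite -big_distrl /= sum_ord_eq ltm mul1n.
Qed.

Lemma sum_interval n lo hi :
  hi <= n -> \sum_(i < n) ((lo <= i) && (i < hi) : nat) = hi - lo.
Proof.
(* With [minn hi n] in place of [hi] the formula holds for every [n], so induction applies. *)
move=> lehi; rewrite -[in RHS](minn_idPl lehi).
elim: n {lehi} => [|n IHn]; first by rewrite big_ord0; lia.
by rewrite big_ord_recr IHn /=; lia.
Qed.

(** The intervals from [F r] to [F r.+1] tile the interval from [0] to [F n]. *)
Lemma sum_pieces (F : nat -> nat) i n : F 0 = 0 -> (forall m, F m <= F m.+1) ->
  \sum_(r < n) ((F r <= i) && (i < F r.+1) : nat) = (i < F n).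
Proof.
move=> F0 leF; elim: n => [|n IHn]; first by rewrite big_ord0 F0.
by rewrite big_ord_recr IHn /=; have := leF n; lia.
Qed.

(** * Arc diagrams *)

Section Diagrams.

Context (H : nat).
Implicit Type D : arcdiag.

(** * Diagrams without crossings *)

Definition twos D x := \sum_(y < H.+1) D.1 x y.
Definition hits D y := \sum_(x < H.+1) D.1 x y.

Definition supported D :=
  forall m r, 0 < D.1 m r -> [/\ 0 < r, r < m & m <= H].

(** Excluded are the sources of the moves: (A) and (C) start from the same pair of crossing arcs,
    (B) and (D) from the same pole under an arc. *)
Definition no_cross D :=
  (forall m n r s, s < r -> r < n -> n < m -> 0 < D.1 m r -> 0 < D.1 n s -> False)
  /\ (forall m r s, s < r -> r < m -> 0 < D.1 m s -> 0 < D.2 r -> False).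

(** An excess arc [(m, r)] of [D] is compensated in [D'] by an arc [(m, s)], and at [r] by an arc
    [(n, r)] or a pole. Since shorter arcs agree, [s < r] and [m < n], so [D'] would have a
    crossing. *)
Lemma no_cross_le D D' : no_cross D' -> supported D -> supported D' ->
  (forall x, twos D x = twos D' x) ->
  (forall y, hits D y + D.2 y = hits D' y + D'.2 y) ->
  forall m r, (forall n s, n - s < m - r -> D.1 n s = D'.1 n s) ->
  D.1 m r <= D'.1 m r.
Proof.
move=> [ncA ncB] sD sD' eq2 eq1 m r IH; rewrite leqNgt; apply/negP => lt_mr.
have [r0 ltrm lemH] : [/\ 0 < r, r < m & m <= H] by apply: sD; lia.
have [s _ lt_s] : exists2 s, s < H.+1 & D.1 m s < D'.1 m s.
  by apply: (eq_sum_gt_ex _ _ _ r (eq2 m)) => //; lia.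
have [s0 ltsm _] : [/\ 0 < s, s < m & m <= H] by apply: sD'; lia.
have ltsr : s < r.
  rewrite ltnNge; apply/negP => le_rs.
  have ne_rs : r <> s by move=> e; subst s; lia.
  by have := IH m s ltac:(lia); lia.
have [[n lt_n]|lt_p] : (exists n, D.1 n r < D'.1 n r) \/ D.2 r < D'.2 r.
- case: (ltnP (D.2 r) (D'.2 r)) => [|le_p]; [by right | left].
  have [n _ lt_n] : exists2 n, n < H.+1 & D.1 n r < D'.1 n r.
    have [lt_h|/eqP eq_h] : hits D r < hits D' r \/ hits D r == hits D' r.
    + have := eq1 r; lia.
    + exact: ltn_sum_ex lt_h.
    + by apply: (eq_sum_gt_ex _ (D.1^~ r) (D'.1^~ r) m eq_h); lia.
  by exists n.
- have [_ ltrn _] : [/\ 0 < r, r < n & n <= H] by apply: sD'; lia.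
  apply: (ncA n m r s) => //; try lia.
  have [ltnm|//|e] := ltngtP n m; last by subst n; lia.
  by have := IH n r ltac:(lia); lia.
- by apply: (ncB m r s) => //; lia.
Qed.

Lemma no_cross_unique D D' : no_cross D -> no_cross D' ->
  supported D -> supported D' ->
  (forall x, twos D x = twos D' x) ->
  (forall y, hits D y + D.2 y = hits D' y + D'.2 y) -> diag_eq D D'.
Proof.
move=> nc nc' sD sD' eq2 eq1.
have eqa m r : D.1 m r = D'.1 m r.
  elim: {m r}_.+1 {-2}m {-2}r (ltnSn (m - r)) => // d IH m r ltd.
  have IHmr n s : n - s < m - r -> D.1 n s = D'.1 n s by move=> ?; apply: IH; lia.
  apply/eqP; rewrite eqn_leq; apply/andP; split; apply: no_cross_le => //.
  by move=> n s /IHmr.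
split=> // y; have := eq1 y.
suff -> : hits D y = hits D' y by lia.
by apply: eq_bigr => x _; apply: eqa.
Qed.

(** * Forced arcs and diagrams with all possible crossings *)

Variable k : nat -> nat.

(* The [k m] boxes of row [m] below an entry 1 force [k m] arcs [(m, m-1)]. *)
Definition forced m r := if r == m.-1 then k m else 0.

Definition stacked D := forall m, k m <= D.1 m m.-1.

Lemma forced_le D m r : stacked D -> forced m r <= D.1 m r.
Proof. by rewrite /forced; case: eqP => // -> /(_ m). Qed.

Lemma forced0 m r : r.+1 < m -> forced m r = 0.
Proof. by rewrite /forced; case: eqP => // ->; lia. Qed.

(** The excluded patterns are the results of (A) and (B). Undoing the move takes away the inner arc,
    or the arc beside the pole, which must therefore be free; the outer arc spans at least two rows
    and is never forced. *)
Definition all_cross D :=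
  (forall m n r s, s < r -> r < n -> n < m ->
     0 < D.1 m s -> forced n r < D.1 n r -> False)
  /\ (forall m r s, s < r -> r < m -> forced m r < D.1 m r -> 0 < D.2 s -> False).

(** The argument of [no_cross_le], with agreement on lexicographically smaller arcs instead of
    shorter ones. Now [r < s], and [(m, s)] is free in [D'] because it exceeds a multiplicity in [D]
    that already covers the forced arcs. *)
Lemma all_cross_le D D' : all_cross D' -> supported D -> supported D' ->
  stacked D -> stacked D' ->
  (forall x, twos D x = twos D' x) ->
  (forall y, hits D y + D.2 y = hits D' y + D'.2 y) ->
  forall m r, (forall n s, n < m \/ n = m /\ s < r -> D.1 n s = D'.1 n s) ->
  D.1 m r <= D'.1 m r.
Proof.
move=> [acA acB] sD sD' kD kD' eq2 eq1 m r IH; rewrite leqNgt; apply/negP => lt_mr.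
have [r0 ltrm lemH] : [/\ 0 < r, r < m & m <= H] by apply: sD; lia.
have [s _ lt_s] : exists2 s, s < H.+1 & D.1 m s < D'.1 m s.
  by apply: (eq_sum_gt_ex _ _ _ r (eq2 m)) => //; lia.
have [s0 ltsm _] : [/\ 0 < s, s < m & m <= H] by apply: sD'; lia.
have ltrs : r < s.
  rewrite ltnNge; apply/negP => le_rs.
  have ne_rs : r <> s by move=> e; subst s; lia.
  by have := IH m s ltac:(lia); lia.
have free : forced m s < D'.1 m s by apply: leq_ltn_trans lt_s; apply: forced_le.
have [[n lt_n]|lt_p] : (exists n, D.1 n r < D'.1 n r) \/ D.2 r < D'.2 r.
- case: (ltnP (D.2 r) (D'.2 r)) => [|le_p]; [by right | left].
  have [n _ lt_n] : exists2 n, n < H.+1 & D.1 n r < D'.1 n r.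
    have [lt_h|/eqP eq_h] : hits D r < hits D' r \/ hits D r == hits D' r.
    + have := eq1 r; lia.
    + exact: ltn_sum_ex lt_h.
    + by apply: (eq_sum_gt_ex _ (D.1^~ r) (D'.1^~ r) m eq_h); lia.
  by exists n.
- have [_ ltrn _] : [/\ 0 < r, r < n & n <= H] by apply: sD'; lia.
  apply: (acA n m s r) => //; try lia.
  have [ltnm|//|e] := ltngtP n m; last by subst n; lia.
  by have := IH n r ltac:(lia); lia.
- by apply: (acB m s r) => //; lia.
Qed.

Lemma all_cross_unique D D' : all_cross D -> all_cross D' ->
  supported D -> supported D' -> stacked D -> stacked D' ->
  (forall x, twos D x = twos D' x) ->
  (forall y, hits D y + D.2 y = hits D' y + D'.2 y) -> diag_eq D D'.
Proof.
move=> ac ac' sD sD' kD kD' eq2 eq1.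
have eqa m r : D.1 m r = D'.1 m r.
  elim/ltn_ind: m r => m IHm; elim/ltn_ind => r IHr.
  have IH n s : n < m \/ n = m /\ s < r -> D.1 n s = D'.1 n s.
    by case=> [/IHm->|[-> /IHr->]].
  apply/eqP; rewrite eqn_leq; apply/andP; split; apply: all_cross_le => //.
  by move=> n s /IH.
split=> // y; have := eq1 y.
suff -> : hits D y = hits D' y by lia.
by apply: eq_bigr => x _; apply: eqa.
Qed.

(** The excluded patterns are the results of (C) and (D), where the arcs that the inverse move takes
    away are free. *)
Definition all_overlap D :=
  (forall m n r s, s < r -> r < n -> n < m ->
     forced m n < D.1 m n -> forced r s < D.1 r s -> False)
  /\ (forall m r s, s < r -> r < m -> 0 < D.2 m -> forced r s < D.1 r s -> False).

Lemma free_hit D D' z : stacked D -> supported D' -> hits D z < hits D' z ->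
  exists m, [/\ z < m, m <= H & forced m z < D'.1 m z].
Proof.
move=> kD sD' lt_h; have [m _ lt_m] := ltn_sum_ex _ (D.1^~ z) (D'.1^~ z) lt_h.
exists m.
have [] : [/\ 0 < z, z < m & m <= H] by apply: sD'; lia.
by split=> //; apply: leq_ltn_trans lt_m; apply: forced_le.
Qed.

Lemma free_two D D' x : stacked D -> supported D' -> twos D x < twos D' x ->
  exists s, [/\ 0 < s, s < x & forced x s < D'.1 x s].
Proof.
move=> kD sD' lt_t; have [s _ lt_s] := ltn_sum_ex _ (D.1 x) (D'.1 x) lt_t.
exists s.
have [] : [/\ 0 < s, s < x & x <= H] by apply: sD'; lia.
by split=> //; apply: leq_ltn_trans lt_s; apply: forced_le.
Qed.

(* An excess left end at [x] of one diagram is a right end or a pole of the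
   other one, where an excess left end [z] lies further down. *)
Lemma hits_conflict D D' x z : all_cross D' -> all_overlap D' ->
  supported D' -> stacked D ->
  twos D x + hits D x + D.2 x = twos D' x + hits D' x + D'.2 x ->
  x < z -> hits D' x < hits D x -> hits D z < hits D' z -> False.
Proof.
move=> [_ acB] [aoC aoD] sD' kD tot ltxz lt_x lt_z.
have [m [ltzm _ free_m]] := free_hit D D' z kD sD' lt_z.
have [le2|lt2] := leqP (twos D' x) (twos D x).
  by apply: (acB m z x) => //; lia.
have [s [s0 ltsx free_s]] := free_two D D' x kD sD' lt2.
by apply: (aoC m z x s).
Qed.

(** As the left ends at [x] agree, the surplus right ends of [D] there are surplus poles of [D'],
    while [D'] has a free arc with right end [z] above [x]. *)
Lemma twos_conflict D D' x z : all_overlap D' ->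
  supported D' -> stacked D ->
  twos D x + hits D x + D.2 x = twos D' x + hits D' x + D'.2 x ->
  hits D x = hits D' x ->
  z < x -> twos D' x < twos D x -> twos D z < twos D' z -> False.
Proof.
move=> [_ aoD] sD' kD tot eqh ltzx lt_x lt_z.
have [s [s0 ltsz free_s]] := free_two D D' z kD sD' lt_z.
by apply: (aoD x z s) => //; lia.
Qed.

Lemma sum_hits D : \sum_(y < H.+1) hits D y = \sum_(x < H.+1) twos D x.
Proof. by rewrite /hits exchange_big. Qed.

Lemma twos_gt_H D x : supported D -> H < x -> twos D x = 0.
Proof.
move=> sD ltx; rewrite /twos big1 // => y _; apply/eqP; rewrite -leqn0 leqNgt.
by apply/negP => /sD[]; lia.
Qed.

(** Both diagrams have equally many left ends in total, so a difference in left ends would occur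
    with both signs and contradict [hits_conflict]. Right ends are treated alike, and the row data
    then determine the diagram. *)
Lemma extremal_unique D D' :
  all_cross D -> all_cross D' -> all_overlap D -> all_overlap D' ->
  supported D -> supported D' -> stacked D -> stacked D' ->
  (forall x, twos D x + hits D x + D.2 x = twos D' x + hits D' x + D'.2 x) ->
  \sum_(x < H.+1) twos D x = \sum_(x < H.+1) twos D' x -> diag_eq D D'.
Proof.
move=> ac ac' ao ao' sD sD' kD kD' tot eqb.
have eqh y : y < H.+1 -> hits D y = hits D' y.
  move=> lty; apply: NNPP => ne_y.
  have [||x [z [ltxz _ cf]]] := eq_sum_diff H.+1 (hits D) (hits D').
  - by rewrite !sum_hits.
  - by exists y.
  case: cf => -[lt_x lt_z].
  - by apply: (hits_conflict D D' x z).
  - by apply: (hits_conflict D' D x z).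
have eqt x : twos D x = twos D' x.
  have [ltx|ltHx] := leqP x H; last by rewrite !twos_gt_H.
  apply: NNPP => ne_x.
  have [//||z [x' [ltzx ltx' cf]]] := eq_sum_diff H.+1 (twos D) (twos D').
    by exists x.
  have eqx' := eqh _ ltx'.
  case: cf => -[lt_z lt_x].
  - exact: (twos_conflict D' D x' z ao sD kD' (esym (tot x')) (esym eqx')).
  - exact: (twos_conflict D D' x' z ao' sD' kD (tot x') eqx').
by apply: all_cross_unique => // y; have := tot y; rewrite eqt; lia.
Qed.

(** * Admissible diagrams and the exchange of arcs *)

Definition admissible (rho : nat -> nat) b D :=
  [/\ supported D, stacked D,
      forall x, twos D x + hits D x + D.2 x = rho x
    & \sum_(x < H.+1) twos D x = b].

Lemma twos_exchange2 D D' p1 q1 p2 q2 p3 q3 p4 q4 :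
  q1 <= H -> q2 <= H -> q3 <= H -> q4 <= H ->
  (forall x y, D'.1 x y + ind2 x y p1 q1 + ind2 x y p2 q2
               = D.1 x y + ind2 x y p3 q3 + ind2 x y p4 q4) ->
  forall x, twos D' x + (x == p1) + (x == p2) = twos D x + (x == p3) + (x == p4).
Proof.
move=> le1 le2 le3 le4 eqD x.
have := eq_bigr (fun y : 'I_H.+1 => D.1 x y + ind2 x y p3 q3 + ind2 x y p4 q4)
  (fun (y : 'I_H.+1) (_ : true) => eqD x y).
by move/(_ 0 addn (index_enum _)); rewrite !big_split /= !sum_ind2_row.
Qed.

Lemma hits_exchange2 D D' p1 q1 p2 q2 p3 q3 p4 q4 :
  p1 <= H -> p2 <= H -> p3 <= H -> p4 <= H ->
  (forall x y, D'.1 x y + ind2 x y p1 q1 + ind2 x y p2 q2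
               = D.1 x y + ind2 x y p3 q3 + ind2 x y p4 q4) ->
  forall y, hits D' y + (y == q1) + (y == q2) = hits D y + (y == q3) + (y == q4).
Proof.
move=> le1 le2 le3 le4 eqD y.
have := eq_bigr (fun x : 'I_H.+1 => D.1 x y + ind2 x y p3 q3 + ind2 x y p4 q4)
  (fun (x : 'I_H.+1) (_ : true) => eqD x y).
by move/(_ 0 addn (index_enum _)); rewrite !big_split /= !sum_ind2_col.
Qed.

Lemma twos_exchange1 D D' p q p3 q3 : q <= H -> q3 <= H ->
  (forall x y, D'.1 x y + ind2 x y p q = D.1 x y + ind2 x y p3 q3) ->
  forall x, twos D' x + (x == p) = twos D x + (x == p3).
Proof.
move=> le le3 eqD x.
have := twos_exchange2 D D' p q 0 0 p3 q3 0 0 le (leq0n H) le3 (leq0n H) _ x.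
by move=> /(_ (fun x y => congr1 (addn^~ _) (eqD x y)))/addIn.
Qed.

Lemma hits_exchange1 D D' p q p3 q3 : p <= H -> p3 <= H ->
  (forall x y, D'.1 x y + ind2 x y p q = D.1 x y + ind2 x y p3 q3) ->
  forall y, hits D' y + (y == q) = hits D y + (y == q3).
Proof.
move=> le le3 eqD y.
have := hits_exchange2 D D' p q 0 0 p3 q3 0 0 le (leq0n H) le3 (leq0n H) _ y.
by move=> /(_ (fun x y => congr1 (addn^~ _) (eqD x y)))/addIn.
Qed.

Lemma sum_eq_le p : p <= H -> \sum_(x < H.+1) (val x == p : nat) = 1.
Proof. by rewrite sum_ord_eq ltnS => ->. Qed.

Lemma sum_shift (f g : nat -> nat) p q : p <= H -> q <= H ->
  (forall x, f x + (x == p) = g x + (x == q)) ->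
  \sum_(x < H.+1) f x = \sum_(x < H.+1) g x.
Proof.
move=> lep leq eqf; apply: (@addIn 1).
rewrite -{1}(sum_eq_le p) // -(sum_eq_le q) // -!big_split /=.
by apply: eq_bigr => x _; apply: eqf.
Qed.

Lemma ind2_gt0 x y m r : 0 < ind2 x y m r -> x = m /\ y = r.
Proof. by rewrite /ind2; do 2![case: eqP => // ?]. Qed.

(** Performs a move or its inverse on two free arcs. As their positions differ, one copy of each
    beyond the forced ones suffices to remove both. *)
Lemma exchange2 D p1 q1 p2 q2 p3 q3 p4 q4 : supported D -> stacked D ->
  (p1 != p2) || (q1 != q2) ->
  forced p1 q1 < D.1 p1 q1 -> forced p2 q2 < D.1 p2 q2 ->
  [/\ 0 < q3, q3 < p3 & p3 <= H] -> [/\ 0 < q4, q4 < p4 & p4 <= H] ->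
  exists D', [/\ supported D', stacked D',
    forall x y, D'.1 x y + ind2 x y p1 q1 + ind2 x y p2 q2
                = D.1 x y + ind2 x y p3 q3 + ind2 x y p4 q4
    & forall y, D'.2 y = D.2 y].
Proof.
move=> sD kD ne12 f1 f2 ok3 ok4.
(* This bound makes the truncated subtraction below exact and keeps the forced arcs in place. *)
have le x y : forced x y + ind2 x y p1 q1 + ind2 x y p2 q2 <= D.1 x y.
  have := forced_le D x y kD; rewrite /ind2.
  case: (x =P p1) => [->|_]; case: (y =P q1) => [->|_] /=;
  case: eqP => [?|_] /=; try case: eqP => [?|_] /=; subst=> //;
    move: ne12; rewrite ?eqxx //; lia.
exists (fun x y => D.1 x y + ind2 x y p3 q3 + ind2 x y p4 q4
                   - (ind2 x y p1 q1 + ind2 x y p2 q2), D.2).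
split=> //= [m r /= gt0|m /=|x y]; last by have := le x y; lia.
- have [|//|] : [\/ 0 < D.1 m r, 0 < ind2 m r p3 q3 | 0 < ind2 m r p4 q4].
  + have [|?] := posnP (D.1 m r); last by constructor 1.
    have [|?] := posnP (ind2 m r p3 q3); last by constructor 2.
    by move=> ? ?; constructor 3; lia.
  + exact: sD.
  + by move=> /ind2_gt0[-> ->].
  + by move=> /ind2_gt0[-> ->].
- by have := le m m.-1; rewrite /forced eqxx; lia.
Qed.

Lemma exchange1 D p q p3 q3 u v : supported D -> stacked D ->
  forced p q < D.1 p q -> 0 < D.2 u -> [/\ 0 < q3, q3 < p3 & p3 <= H] ->
  exists D', [/\ supported D', stacked D',
    forall x y, D'.1 x y + ind2 x y p q = D.1 x y + ind2 x y p3 q3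
    & forall y, D'.2 y + ind1 y u = D.2 y + ind1 y v].
Proof.
move=> sD kD f1 u0 ok3.
have le x y : forced x y + ind2 x y p q <= D.1 x y.
  have := forced_le D x y kD; rewrite /ind2.
  by case: (x =P p) => [->|_]; case: (y =P q) => [->|_] /=; lia.
exists (fun x y => D.1 x y + ind2 x y p3 q3 - ind2 x y p q,
        fun y => D.2 y + ind1 y v - ind1 y u).
split=> /= [m r /= gt0|m /=|x y|y]; last 2 first.
- by have := le x y; lia.
- by rewrite /ind1; case: (y =P u) => [->|_]; lia.
- have [|] : 0 < D.1 m r \/ 0 < ind2 m r p3 q3 by lia.
  + exact: sD.
  + by move=> /ind2_gt0[-> ->].
- by have := le m m.-1; rewrite /forced eqxx; lia.
Qed.

Lemma free_far D m r : r.+1 < m -> (forced m r < D.1 m r) = (0 < D.1 m r).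
Proof. by move=> ltr; rewrite forced0. Qed.

(** Every crossing can be resolved by (A) or (B), which keep the right ends and so stay inside one
    LR-tableau. The arcs taken away span at least two rows and are free. *)
Lemma no_move_no_cross rho b D : admissible rho b D ->
  (forall D', arc_move D D' -> admissible rho b D' ->
     (forall x, twos D' x = twos D x) -> False) -> no_cross D.
Proof.
move=> [sD kD tot eqb] no; split.
- move=> m n r s ltsr ltrn ltnm a1 a2.
  have [_ _ lemH] := sD _ _ a1; have [s0 _ _] := sD _ _ a2.
  have [|||||D' [sD' kD' eqD eqp]] := exchange2 D m r n s m s n r sD kD.
  1-5: by try split; rewrite // ?free_far //; lia.
  have eqt x : twos D' x = twos D x.
    have := twos_exchange2 _ _ _ _ _ _ _ _ _ _ _ _ _ _ eqD x; lia.
  have eqh y : hits D' y = hits D y.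
    have := hits_exchange2 _ _ _ _ _ _ _ _ _ _ _ _ _ _ eqD y; lia.
  apply: (no D') => //.
  + by left; exists m, n, r, s.
  + split=> // [x|]; first by rewrite eqt eqh eqp.
    by rewrite -eqb; apply: eq_bigr.
- move=> m r s ltsr ltrm a p.
  have [s0 _ lemH] := sD _ _ a.
  have [||D' [sD' kD' eqD eqp]] := exchange1 D m s m r r s sD kD _ p.
  1-2: by try split; rewrite // ?free_far //; lia.
  have eqt x : twos D' x = twos D x.
    have := twos_exchange1 _ _ _ _ _ _ _ _ eqD x; lia.
  have eqh y : hits D' y + (y == s) = hits D y + (y == r).
    have := hits_exchange1 _ _ _ _ _ _ _ _ eqD y; lia.
  apply: (no D') => //.
  + by right; right; left; exists m, r, s.
  + split=> // [x|]; last by rewrite -eqb; apply: eq_bigr.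
    rewrite -tot eqt; have := eqh x; have := eqp x; rewrite /ind1; lia.
Qed.

(** The inverses of (A) and (B) also keep the right ends. The bound on [rho] puts each pole in a
    positive row, so that it may become the left end of an arc. *)
Lemma no_unmove_all_cross rho b D : (forall x, 0 < rho x -> 0 < x <= H) -> admissible rho b D ->
  (forall D', arc_move D' D -> admissible rho b D' ->
     (forall x, twos D' x = twos D x) -> False) -> all_cross D.
Proof.
move=> rho0 [sD kD tot eqb] no; split.
- move=> m n r s ltsr ltrn ltnm a1 a2.
  have [s0 _ lemH] := sD _ _ a1.
  have [|||||D' [sD' kD' eqD eqp]] := exchange2 D m s n r m r n s sD kD.
  1-5: by try split; rewrite // ?free_far //; lia.
  have eqt x : twos D' x = twos D x.
    have := twos_exchange2 _ _ _ _ _ _ _ _ _ _ _ _ _ _ eqD x; lia.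
  have eqh y : hits D' y = hits D y.
    have := hits_exchange2 _ _ _ _ _ _ _ _ _ _ _ _ _ _ eqD y; lia.
  apply: (no D') => //.
  + by left; exists m, n, r, s; split=> // *; rewrite (eqD, eqp).
  + split=> // [x|]; first by rewrite eqt eqh eqp.
    by rewrite -eqb; apply: eq_bigr.
- move=> m r s ltsr ltrm a p.
  have [_ _ lemH] : [/\ 0 < r, r < m & m <= H] by apply: sD; lia.
  have s0 : 0 < s by have := rho0 s; have := tot s; lia.
  have [||D' [sD' kD' eqD eqp]] := exchange1 D m r m s s r sD kD _ p.
  1-2: by try split; rewrite // ?free_far //; lia.
  have eqt x : twos D' x = twos D x.
    have := twos_exchange1 _ _ _ _ _ _ _ _ eqD x; lia.
  have eqh y : hits D' y + (y == r) = hits D y + (y == s).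
    have := hits_exchange1 _ _ _ _ _ _ _ _ eqD y; lia.
  apply: (no D') => //.
  + by right; right; left; exists m, r, s; split=> // *; rewrite (eqD, eqp).
  + split=> // [x|]; last by rewrite -eqb; apply: eq_bigr.
    rewrite -tot eqt; have := eqh x; have := eqp x; rewrite /ind1; lia.
Qed.

(** The inverses of (C) and (D) shift right ends, so here [D'] ranges over diagrams with other row
    contents as well. *)
Lemma no_unmove_all_overlap rho b D : (forall x, 0 < rho x -> 0 < x <= H) -> admissible rho b D ->
  (forall D', arc_move D' D -> admissible rho b D' -> False) -> all_overlap D.
Proof.
move=> rho0 [sD kD tot eqb] no; split.
- move=> m n r s ltsr ltrn ltnm a1 a2.
  have [_ _ lemH] : [/\ 0 < n, n < m & m <= H] by apply: sD; lia.
  have [s0 _ _] : [/\ 0 < s, s < r & r <= H] by apply: sD; lia.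
  have [|||||D' [sD' kD' eqD eqp]] := exchange2 D m n r s m r n s sD kD.
  1-5: by try split; rewrite // ?free_far //; lia.
  have eqt x : twos D' x + (x == r) = twos D x + (x == n).
    have := twos_exchange2 _ _ _ _ _ _ _ _ _ _ _ _ _ _ eqD x; lia.
  have eqh y : hits D' y + (y == n) = hits D y + (y == r).
    have := hits_exchange2 _ _ _ _ _ _ _ _ _ _ _ _ _ _ eqD y; lia.
  apply: (no D') => //.
  + by right; left; exists m, n, r, s; split=> // *; rewrite (eqD, eqp).
  + split=> // [x|]; first by have := tot x; have := eqt x; have := eqh x; rewrite eqp; lia.
    by rewrite -eqb; apply: (sum_shift _ _ r n) => //; lia.
- move=> m r s ltsr ltrm p a.
  have [s0 _ lerH] : [/\ 0 < s, s < r & r <= H] by apply: sD; lia.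
  have lemH : m <= H by have := rho0 m; have := tot m; lia.
  have [||D' [sD' kD' eqD eqp]] := exchange1 D r s m s m r sD kD _ p.
  1-2: by try split; rewrite // ?free_far //; lia.
  have eqt x : twos D' x + (x == r) = twos D x + (x == m).
    have := twos_exchange1 _ _ _ _ _ _ _ _ eqD x; lia.
  have eqh y : hits D' y = hits D y.
    have := hits_exchange1 _ _ _ _ _ _ _ _ eqD y; lia.
  apply: (no D') => //.
  + by right; right; right; exists m, r, s; split=> // *; rewrite (eqD, eqp).
  + split=> // [x|].
      by rewrite -tot; have := eqt x; have := eqh x; have := eqp x; rewrite /ind1; lia.
    by rewrite -eqb; apply: (sum_shift _ _ r m) => //; lia.
Qed.

(** * The weight of a diagram, from a concave function of the arc lengths *)

Definition arc_weight m r := (m - r) * (2 * H - (m - r)).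

Definition weight D := \sum_(x < H.+1) \sum_(y < H.+1) D.1 x y * arc_weight x y.

Lemma weight_exchange2 D D' p1 q1 p2 q2 p3 q3 p4 q4 :
  q1 < p1 <= H -> q2 < p2 <= H -> q3 < p3 <= H -> q4 < p4 <= H ->
  (forall x y, D'.1 x y + ind2 x y p1 q1 + ind2 x y p2 q2
               = D.1 x y + ind2 x y p3 q3 + ind2 x y p4 q4) ->
  weight D' + arc_weight p1 q1 + arc_weight p2 q2
  = weight D + arc_weight p3 q3 + arc_weight p4 q4.
Proof.
move=> le1 le2 le3 le4 eqD.
rewrite -(sum2_ind2 H.+1 H.+1 arc_weight p1 q1) -1?(sum2_ind2 H.+1 H.+1 arc_weight p2 q2); try lia.
rewrite -(sum2_ind2 H.+1 H.+1 arc_weight p3 q3) -1?(sum2_ind2 H.+1 H.+1 arc_weight p4 q4); try lia.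
rewrite -!big_split /=; apply: eq_bigr => x _; rewrite -!big_split /=.
by apply: eq_bigr => y _; rewrite -!mulnDl eqD.
Qed.

Lemma weight_exchange1 D D' p q p3 q3 : q < p <= H -> q3 < p3 <= H ->
  (forall x y, D'.1 x y + ind2 x y p q = D.1 x y + ind2 x y p3 q3) ->
  weight D' + arc_weight p q = weight D + arc_weight p3 q3.
Proof.
move=> le1 le3 eqD.
have := weight_exchange2 D D' p q p q p3 q3 p q le1 le1 le3 le1 _.
by move=> /(_ (fun x y => congr1 (addn^~ _) (eqD x y)))/addIn.
Qed.

Lemma arc_weight_lt m n r s : s <= n -> n <= r -> r <= m -> m <= H ->
  (s < n) || (r < m) -> arc_weight r n < arc_weight m s.
Proof.
move=> les len ler lem lt; rewrite /arc_weight.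
(* Writing all quantities as sums removes the truncated subtractions and leaves a polynomial
   inequality. *)
have [a ea] : exists a, r - n = a by exists (r - n).
have [c ec] : exists c, m - s = a + c.+1 by exists (m - s - a).-1; lia.
have [h eh] : exists h, H = a + c.+1 + h by exists (H - (a + c.+1)); lia.
rewrite ea ec (_ : 2 * H - a = a + 2 * c.+1 + 2 * h); last by lia.
rewrite (_ : 2 * H - (a + c.+1) = a + c.+1 + 2 * h); last by lia.
nia.
Qed.

(** The lengths on both sides have the same sum, so only their squares matter; the difference is
    [2 * (r - s) * (m - n)]. *)
Lemma arc_weight_cross m n r s : s < r -> r < n -> n < m -> m <= H ->
  arc_weight m s + arc_weight n r < arc_weight m r + arc_weight n s.
Proof.
move=> lts ltr ltn lem; rewrite /arc_weight.
have [a ea] : exists a, r = s + a.+1 by exists (r - s).-1; lia.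
have [c ec] : exists c, n = r + c.+1 by exists (n - r).-1; lia.
have [d ed] : exists d, m = n + d.+1 by exists (m - n).-1; lia.
have [h eh] : exists h, H = m + h by exists (H - m); lia.
have em : m - s = a + c + d + 3 by lia.
have e1 : n - r = c.+1 by lia.
have e2 : m - r = c + d + 2 by lia.
have e3 : n - s = a + c + 2 by lia.
rewrite em e1 e2 e3.
have [g eg] : exists g, H = a + c + d + 3 + g by exists (H - (a + c + d + 3)); lia.
rewrite eg.
rewrite (_ : 2 * _ - (a + c + d + 3) = a + c + d + 3 + 2 * g); last by lia.
rewrite (_ : 2 * _ - (c.+1) = 2 * a + c + 2 * d + 5 + 2 * g); last by lia.
rewrite (_ : 2 * _ - (c + d + 2) = 2 * a + c + d + 4 + 2 * g); last by lia.
rewrite (_ : 2 * _ - (a + c + 2) = a + c + 2 * d + 4 + 2 * g); last by lia.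
nia.
Qed.

Lemma supported_exchange2 D D' p1 q1 p2 q2 p3 q3 p4 q4 : supported D ->
  [/\ 0 < q3, q3 < p3 & p3 <= H] -> [/\ 0 < q4, q4 < p4 & p4 <= H] ->
  (forall x y, D'.1 x y + ind2 x y p1 q1 + ind2 x y p2 q2
               = D.1 x y + ind2 x y p3 q3 + ind2 x y p4 q4) -> supported D'.
Proof.
move=> sD ok3 ok4 eqD x y gt0; have := eqD x y.
have [e3|/ind2_gt0[-> ->] //] := posnP (ind2 x y p3 q3).
have [e4|/ind2_gt0[-> ->] //] := posnP (ind2 x y p4 q4).
by move=> eqxy; apply: sD; lia.
Qed.

Lemma supported_exchange1 D D' p q p3 q3 : supported D ->
  [/\ 0 < q3, q3 < p3 & p3 <= H] ->
  (forall x y, D'.1 x y + ind2 x y p q = D.1 x y + ind2 x y p3 q3) ->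
  supported D'.
Proof.
move=> sD ok3 eqD.
apply: (supported_exchange2 D D' p q p3 q3 p3 q3 p3 q3) => // x y.
by rewrite eqD.
Qed.

(** Move (A) preserves the sum of the lengths and relies on concavity; the other moves shorten every
    arc they replace and rely on monotonicity. *)
Lemma arc_move_weight D D' : supported D -> arc_move D D' ->
  supported D' /\ weight D' < weight D.
Proof.
move=> sD; case=> [|[|[|]]].
- move=> [m [n [r [s [ltsr ltrn ltnm eqD _]]]]].
  have [_ _ lemH] : [/\ 0 < r, r < m & m <= H].
    by apply: sD; have := eqD m r; rewrite /ind2 !eqxx; lia.
  have [s0 _ _] : [/\ 0 < s, s < n & n <= H].
    by apply: sD; have := eqD n s; rewrite /ind2 !eqxx; lia.
  split.
    by apply: (supported_exchange2 _ _ _ _ _ _ _ _ _ _ sD _ _ eqD); split; lia.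
  have := weight_exchange2 _ _ _ _ _ _ _ _ _ _ _ _ _ _ eqD.
  have := arc_weight_cross _ _ _ _ ltsr ltrn ltnm lemH; lia.
- move=> [m [n [r [s [ltsr ltrn ltnm eqD _]]]]].
  have [_ _ lemH] : [/\ 0 < r, r < m & m <= H].
    by apply: sD; have := eqD m r; rewrite /ind2 !eqxx; lia.
  have [s0 _ _] : [/\ 0 < s, s < n & n <= H].
    by apply: sD; have := eqD n s; rewrite /ind2 !eqxx; lia.
  split.
    by apply: (supported_exchange2 _ _ _ _ _ _ _ _ _ _ sD _ _ eqD); split; lia.
  have := weight_exchange2 _ _ _ _ _ _ _ _ _ _ _ _ _ _ eqD.
  have := arc_weight_lt m n m r; have := arc_weight_lt n s r s; lia.
- move=> [m [r [s [ltsr ltrm eqD _]]]].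
  have [s0 _ lemH] : [/\ 0 < s, s < m & m <= H].
    by apply: sD; have := eqD m s; rewrite /ind2 !eqxx; lia.
  split.
    by apply: (supported_exchange1 _ _ _ _ _ _ sD _ eqD); split; lia.
  have := weight_exchange1 _ _ _ _ _ _ _ _ eqD.
  have := arc_weight_lt m r m s; lia.
- move=> [m [r [s [ltsr ltrm eqD _]]]].
  have [s0 _ lemH] : [/\ 0 < s, s < m & m <= H].
    by apply: sD; have := eqD m s; rewrite /ind2 !eqxx; lia.
  split.
    by apply: (supported_exchange1 _ _ _ _ _ _ sD _ eqD); split; lia.
  have := weight_exchange1 _ _ _ _ _ _ _ _ eqD.
  have := arc_weight_lt m s r s; lia.
Qed.

Lemma arc_reach_weight D D' : supported D -> arc_reach D D' ->
  diag_eq D D' \/ weight D' < weight D.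
Proof.
move=> sD reach; elim: reach sD => {D D'} [D D' ? _|D D1 D' mv _ IH sD]; first by left.
have [sD1 lt1] := arc_move_weight _ _ sD mv.
right; have [[eqD _]|lt'] := IH sD1; last exact: ltn_trans lt1.
suff -> : weight D' = weight D1 by [].
by apply: eq_bigr => x _; apply: eq_bigr => y _; rewrite eqD.
Qed.

End Diagrams.

(** * First-in first-out matching of entries 2 with entries 1 *)

Section FifoMatching.

Context (H : nat) (k o t : nat -> nat).
Hypotheses (o0 : o 0 = 0) (t_gt_H : forall m, H < m -> t m = 0).
Hypotheses (le_kt : forall m, k m <= t m) (le_ko : forall m, k m.+1 <= o m).
Hypothesis row_lattice : forall m, \sum_(i < m.+1) t i <= \sum_(i < m) o i.

(** [T m] and [O m] count the free entries 2 and 1 above row [m]; the forced arcs of row [i.+1] use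
    up [k i.+1] entries 1 of row [i]. *)
Let T m := \sum_(i < m) (t i - k i).
Let O m := \sum_(i < m) (o i - k i.+1).

(* The [i]-th free entry 2 is matched with the [i]-th free entry 1, both
   listed by rows from the top. *)
Let fifo m r :=
  \sum_(i < T H.+1) ((T m <= i) && (i < T m.+1)) * ((O r <= i) && (i < O r.+1)).

Let k0 : k 0 = 0.
Proof. by have := row_lattice 0; rewrite big_ord_recl !big_ord0 /=; have := le_kt 0; lia. Qed.

Let leT m : T m <= T m.+1. Proof. by rewrite /T big_ord_recr leq_addr. Qed.
Let leO m : O m <= O m.+1. Proof. by rewrite /O big_ord_recr leq_addr. Qed.

Let mono (F : nat -> nat) : (forall m, F m <= F m.+1) ->
  forall m n, m <= n -> F m <= F n.
Proof. by move=> leF m n; apply: (homo_leq leqnn leq_trans). Qed.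

(** Obtained from [row_lattice] by subtracting the forced arcs on both sides; it puts the [i]-th
    free 1 in a row above the [i]-th free 2. *)
Let leTO m : T m.+1 <= O m.
Proof.
have eT n : T n + \sum_(i < n) k i = \sum_(i < n) t i.
  by rewrite -big_split; apply: eq_bigr => i _; rewrite /= subnK.
have eO n : O n + \sum_(i < n) k i.+1 = \sum_(i < n) o i.
  by rewrite -big_split; apply: eq_bigr => i _; rewrite /= subnK.
have := row_lattice m; rewrite -eT -eO big_ord_recl k0.
by rewrite (eq_bigr (fun i : 'I_m => k i.+1)) // add0n leq_add2r.
Qed.

Let sum_fifo_row m : m <= H -> \sum_(r < H.+1) fifo m r = t m - k m.
Proof.
move=> lem; rewrite exchange_big /=.
transitivity (\sum_(i < T H.+1) ((T m <= i) && (i < T m.+1) : nat)).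
  apply: eq_bigr => i _; rewrite -big_distrr /= sum_pieces //; last by rewrite /O big_ord0.
  have := leTO m; have := mono O leO m H.+1 ltac:(lia); lia.
rewrite sum_interval; last by apply: mono => //; lia.
by rewrite /T big_ord_recr /= addKn.
Qed.

Let sum_fifo_col r : \sum_(m < H.+1) fifo m r <= o r - k r.+1.
Proof.
rewrite exchange_big /= -[X in _ <= X](addKn (O r)).
rewrite (_ : O r + _ = O r.+1); last by rewrite /O big_ord_recr.
(* There may be fewer free entries 2 than 1, so the interval of row [r] can be used fully, not at
   all, or in part. *)
have [leTr|/ltnW leOT] := leqP (O r.+1) (T H.+1).
  rewrite -(sum_interval (T H.+1)) //; apply: leq_sum => i _.
  by rewrite -big_distrl /= sum_pieces //; [lia | rewrite /T big_ord0].
have [le|/ltnW le] := leqP (T H.+1) (O r).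
  rewrite big1 // => i _; rewrite big1 // => m _; have := ltn_ord i; lia.
apply: (@leq_trans (T H.+1 - O r)); last by lia.
rewrite -(sum_interval (T H.+1)) //; apply: leq_sum => i _.
rewrite -big_distrl /= sum_pieces //; [have := ltn_ord i; lia | by rewrite /T big_ord0].
Qed.

(** The forced arcs are added to the matching and the unmatched entries 1 become poles. This shows
    that every LR-tableau has a refinement. *)
Lemma fifo_diagram : exists D, [/\ supported H D, stacked k D,
  forall m, twos H D m = t m & forall r, hits H D r + D.2 r = o r].
Proof.
pose a m r := fifo m r + forced k m r.
have hitsP r : \sum_(m < H.+1) a m r <= o r.
  rewrite big_split /=; apply: (@leq_trans ((o r - k r.+1) + k r.+1)); last first.
    by rewrite subnK.
  apply: leq_add; first exact: sum_fifo_col.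
  rewrite big_ord_recl {1}/forced k0 if_same add0n.
  apply: (@leq_trans (\sum_(i < H) (val i == r : nat) * k r.+1)).
    apply: leq_sum => i _; rewrite /forced /= eq_sym.
    by case: eqP => [<-|]; rewrite ?mul1n.
  by rewrite -big_distrl /= sum_ord_eq; case: (r < H); rewrite ?mul1n.
exists (a, fun r => o r - \sum_(m < H.+1) a m r); split.
- move=> m r; rewrite /= /a.
  have [k0m|k_gt0] := posnP (forced k m r); last first.
    move=> _; move: k_gt0; rewrite /forced; case: eqP => // -> k_gt0.
    have m0 : 0 < m by case: m k_gt0 => //; rewrite k0.
    have m1 : 1 < m.
      by case: m k_gt0 m0 => // -[|//] k1; have := le_ko 0; lia.
    split; try lia.
    by rewrite leqNgt; apply/negP => /t_gt_H t_m; have := le_kt m; lia.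
  rewrite k0m addn0 => gt0.
  have [i _] : exists2 i, i < T H.+1
      & 0 < ((T m <= i) && (i < T m.+1)) * ((O r <= i) && (i < O r.+1)).
    have [|i ? ?] := ltn_sum_ex (T H.+1) (fun=> 0) (fun i =>
      ((T m <= i) && (i < T m.+1)) * ((O r <= i) && (i < O r.+1))).
    + by rewrite big1_eq.
    + by exists i.
  rewrite muln_gt0 !lt0b => /andP[/andP[leTi ltiT] /andP[leOi ltiO]].
  split.
  + by case: r ltiO {gt0 k0m leOi} => //; rewrite /O big_ord1 o0.
  + rewrite ltnNge; apply/negP => /(mono O leO); have := leTO m; lia.
  + rewrite leqNgt; apply/negP => /t_gt_H t_m.
    by move: ltiT; rewrite /T big_ord_recr /= t_m sub0n addn0 -/(T m); lia.
- by move=> m /=; rewrite /a /forced eqxx leq_addl.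
- move=> m; rewrite /twos /= big_split /=.
  have [lem|ltHm] := leqP m H.
    rewrite sum_fifo_row // -[RHS](subnK (le_kt m)); congr (_ + _).
    transitivity (\sum_(r < H.+1) (val r == m.-1 : nat) * k m).
      by apply: eq_bigr => r _; rewrite /forced; case: eqP; rewrite ?mul1n.
    by rewrite -big_distrl /= sum_ord_eq (_ : m.-1 < H.+1) ?mul1n //; lia.
  have km : k m = 0 by have := le_kt m; rewrite t_gt_H //; lia.
  rewrite t_gt_H // !big1 // => r _; first by rewrite /forced km if_same.
  have eT : T m.+1 = T m by rewrite /T big_ord_recr /= t_gt_H // addn0.
  by rewrite /fifo big1 // => i _; rewrite eT; lia.
- by move=> r; rewrite /hits /= subnKC.
Qed.

End FifoMatching.

(** * Partitions, conjugates and minimality *)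

Lemma partition_nth_le l c : is_partition l -> nth 0 l c <= nth 0 l 0.
Proof.
move=> /andP[]; case: l => [|x l] /=; first by rewrite nth_nil.
move=> /(order_path_min (rev_trans leq_trans))/allP le_x _.
case: c => //= c; have [ltc|lec] := ltnP c (size l); last by rewrite nth_default.
by apply: le_x; apply: mem_nth.
Qed.

(** The columns of length at least [r] come first; [0 < r] excludes the default length 0 past the
    last column. *)
Lemma leq_nth_partition l c r : is_partition l -> 0 < r ->
  (r <= nth 0 l c) = (c < conj l r).
Proof.
move=> + r0; elim: l c => [|x l IHl] c pl; first by rewrite nth_nil /conj /=; lia.
have pl' : is_partition l.
  by rewrite /is_partition; move: pl => /andP[/= /path_sorted -> /andP[_ ->]].
rewrite /conj /= -/(conj l r); have [lerx|ltxr] := leqP r x.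
  by case: c => [|c] /=; [rewrite lerx | rewrite IHl // add1n ltnS].
have le0 d : (r <= nth 0 (x :: l) d) = false.
  by have /= := partition_nth_le _ d pl; lia.
rewrite le0 add0n; have := IHl 0 pl'.
by rewrite (le0 1); case: (conj l r) => //; lia.
Qed.

Lemma partition_nth_geq l c c' : is_partition l -> c <= c' ->
  nth 0 l c' <= nth 0 l c.
Proof.
move=> pl lec; have [-> //|nz] := posnP (nth 0 l c').
rewrite leq_nth_partition // (leq_ltn_trans lec) //.
by rewrite -leq_nth_partition.
Qed.

Lemma conj_geq l r r' : r <= r' -> conj l r' <= conj l r.
Proof. by move=> ler; apply: sub_count => x; apply: leq_trans. Qed.

Lemma diag_eqP D D' : diag_eq D D' -> D = D'.
Proof.
case: D D' => [a p] [a' p'] [/= eqa eqp]; congr (_, _).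
  by do 2!apply: functional_extensionality => ?.
exact: functional_extensionality.
Qed.

Lemma no_cross_no_move D D' : no_cross D -> ~ arc_move D D'.
Proof.
move=> [ncA ncB]; case=> [|[|[|]]].
- move=> [m [n [r [s [ltsr ltrn ltnm eqD _]]]]]; apply: (ncA m n r s) => //.
  + by have := eqD m r; rewrite /ind2 !eqxx; lia.
  + by have := eqD n s; rewrite /ind2 !eqxx; lia.
- move=> [m [n [r [s [ltsr ltrn ltnm eqD _]]]]]; apply: (ncA m n r s) => //.
  + by have := eqD m r; rewrite /ind2 !eqxx; lia.
  + by have := eqD n s; rewrite /ind2 !eqxx; lia.
- move=> [m [r [s [ltsr ltrm eqD eqp]]]]; apply: (ncB m r s) => //.
  + by have := eqD m s; rewrite /ind2 !eqxx; lia.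
  + by have := eqp r; rewrite /ind1 !eqxx; lia.
- move=> [m [r [s [ltsr ltrm eqD eqp]]]]; apply: (ncB m r s) => //.
  + by have := eqD m s; rewrite /ind2 !eqxx; lia.
  + by have := eqp r; rewrite /ind1 !eqxx; lia.
Qed.

Lemma no_cross_minimal beta (S : kfilling -> Prop) P :
  no_cross (kdiag beta P) -> S P -> minimal_in beta S P.
Proof.
move=> nc SP; split=> // P' _; rewrite /arc_le.
move e: (kdiag beta P) nc => D nc reach; rewrite -e in nc *.
by case: reach e nc => [D1 D2 /diag_eqP -> <- //|D1 D2 D3 mv _ eD nc];
  case: (no_cross_no_move _ D2 nc); rewrite eD.
Qed.

Lemma bounded_max (T : Type) (S : T -> Prop) (f : T -> nat) B :
  (exists x, S x) -> (forall x, S x -> f x <= B) ->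
  exists x, S x /\ forall y, S y -> f y <= f x.
Proof.
move=> [x0 Sx0] leB.
elim: {x0}(B - f x0) {-2}x0 (leqnn (B - f x0)) Sx0 => [|d IHd] x led Sx.
  by exists x; split=> // y /leB; lia.
have [[y [Sy lt_xy]]|no] := classic (exists y, S y /\ f x < f y).
  by apply: (IHd y) => //; have := leB y Sy; lia.
exists x; split=> // y Sy; rewrite leqNgt; apply/negP => lt_xy.
by apply: no; exists y.
Qed.

(** * Tableaux *)

Section Tableaux.

Context (alpha beta gamma : seq nat).
Hypotheses (Hbeta : is_partition beta) (Hgamma : is_partition gamma).
Hypothesis Hsub : forall c, nth 0 gamma c <= nth 0 beta c.

Local Notation H := (bH beta).
Local Notation N := (bN beta).
Local Notation inb := (in_skew beta gamma).

Lemma in_skewE r c :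
  inb r c = [&& 0 < r, conj gamma r <= c & c < conj beta r].
Proof.
rewrite /in_skew; case: r => [|r]; first by rewrite ltn0.
by rewrite (leq_nth_partition _ c _ Hbeta) // ltnNge (leq_nth_partition _ c _ Hgamma) // -leqNgt.
Qed.

Lemma conj_size r : conj beta r <= N. Proof. exact: count_size. Qed.

Lemma conj_sub r : 0 < r -> conj gamma r <= conj beta r.
Proof.
move=> r0; rewrite leqNgt; apply/negP => lt.
have := leq_nth_partition _ (conj beta r) r Hgamma r0; rewrite lt => le.
have := leq_nth_partition _ (conj beta r) r Hbeta r0; rewrite ltnn.
by rewrite (leq_trans le (Hsub _)).
Qed.

Lemma in_skew_bounds r c : inb r c -> [/\ 0 < r, r <= H & c < N].
Proof.
move=> inrc; have := inrc; rewrite in_skewE => /and3P[r0 _ ltc].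
split=> //; last exact: leq_trans ltc (conj_size r).
have /andP[_ le] : (nth 0 gamma c < r) && (r <= nth 0 beta c) by [].
exact: leq_trans le (partition_nth_le _ _ Hbeta).
Qed.

Definition row_size r := \sum_(c < N) (inb r c : nat).
Definition stack_size r := \sum_(c < N) (inb r c && inb r.-1 c : nat).

Lemma row_sizeE r : 0 < r -> row_size r = conj beta r - conj gamma r.
Proof.
move=> r0; rewrite -(sum_interval N) ?conj_size //.
by apply: eq_bigr => c _; rewrite in_skewE r0.
Qed.

(** Conjugates decrease, so the lower row begins and ends further left; the overlap starts with the
    upper row and ends with the lower one. *)
Lemma stack_sizeE r : 0 < r -> stack_size r.+1 = conj beta r.+1 - conj gamma r.
Proof.
move=> r0; rewrite -(sum_interval N) ?conj_size //.
apply: eq_bigr => c _; rewrite !in_skewE r0 /=.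
have := conj_geq beta r r.+1 (leqnSn r); have := conj_geq gamma r r.+1 (leqnSn r).
lia.
Qed.

Lemma row_size_bounds r : 0 < row_size r -> 0 < r <= H.
Proof.
move=> gt0; have [|c _] := ltn_sum_ex N (fun=> 0) (fun c => inb r c : nat).
  by rewrite big1_eq.
by rewrite lt0b => /in_skew_bounds[-> ->].
Qed.

Definition LR_filling (G : filling) :=
  [/\ forall r c, ~~ inb r c -> G r c = 0,
      forall r c, inb r c -> G r c = 1 \/ G r c = 2
    & forall r c, inb r c -> inb r.+1 c -> G r c < G r.+1 c].

Lemma LR_is_filling G : is_LR alpha beta gamma G -> LR_filling G.
Proof. by case=> ? ? _ _ [? _]; split. Qed.

(** * Fillings with strictly increasing columns *)

Section Filling.

Variable G : filling.
Hypothesis fG : LR_filling G.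

Lemma filling_in r c : 0 < G r c -> inb r c.
Proof. by case: fG => out _ _; apply: contraLR => /out ->. Qed.

Lemma filling_12 r c : inb r c = (G r c == 1) + (G r c == 2) :> nat.
Proof.
case: fG => out val _; case: (boolP (inb r c)) => [/val[]->|/out->] //.
Qed.

Lemma rcount_12 r : rcount beta G 1 r + rcount beta G 2 r = row_size r.
Proof. by rewrite -big_split; apply: eq_bigr => c _; rewrite filling_12. Qed.

Lemma filling_stack r c : inb r c -> inb r.+1 c -> G r c = 1 /\ G r.+1 c = 2.
Proof.
case: fG => _ val col in1 in2; have := col _ _ in1 in2.
by case: (val _ _ in1) => ->; case: (val _ _ in2) => ->.
Qed.

Lemma sum_row_size : \sum_(r < H.+1) row_size r = tcount beta G 1 + tcount beta G 2.
Proof. by rewrite -big_split; apply: eq_bigr => r _; rewrite -rcount_12. Qed.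

(* Left of column [c0], every 1 in a row above the bottom [M] of column [c0]
   has a 2 right below it. *)
Lemma row_lattice_col :
  (forall m, \sum_(r < m.+1) rcount beta G 2 r <= \sum_(r < m) rcount beta G 1 r) ->
  forall c0, ccount_from beta G 2 c0 <= ccount_from beta G 1 c0.
Proof.
move=> rowP c0; have [ltc0|lec0] := ltnP c0 N; last first.
  by rewrite /ccount_from big_geq.
set M := nth 0 beta c0.
have split_sum k n : \sum_(r < n) rcount beta G k r =
    \sum_(0 <= c < c0) \sum_(r < n) (G r c == k : nat)
    + \sum_(c0 <= c < N) \sum_(r < n) (G r c == k : nat).
  by rewrite -big_cat_nat ?big_mkord 1?exchange_big //; apply: ltnW.
have leMH : M <= H by apply: partition_nth_le.
have restrict k n m c : 0 < k -> n <= m -> (forall r, n <= r -> r < m -> G r c != k) ->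
    \sum_(r < m) (G r c == k : nat) = \sum_(r < n) (G r c == k : nat).
  move=> k0 lenm ne; rewrite -!(big_mkord xpredT (fun r => G r c == k : nat)).
  rewrite (@big_cat_nat _ _ _ n) //= [X in _ + X]big_nat_cond [X in _ + X]big1 ?addn0 //.
  by move=> r /andP[/andP[ler ltr] _]; rewrite (negbTE (ne r ler ltr)).
have eq2 : ccount_from beta G 2 c0
    = \sum_(c0 <= c < N) \sum_(r < M.+1) (G r c == 2 : nat).
  apply: eq_big_nat => c /andP[lec _]; apply: restrict => // r ltr _.
  apply/eqP => e; have : inb r c by apply: filling_in; rewrite e.
  rewrite /in_skew; have := partition_nth_geq _ _ _ Hbeta lec; rewrite -/M; lia.
have le1 : \sum_(c0 <= c < N) \sum_(r < M) (G r c == 1 : nat)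
    <= ccount_from beta G 1 c0.
  apply: leq_sum => c _; rewrite -!(big_mkord xpredT (fun r => G r c == 1 : nat)).
  by rewrite [X in _ <= X](@big_cat_nat _ _ _ M) //= ?leq_addr //; lia.
have le12 : \sum_(0 <= c < c0) \sum_(r < M) (G r c == 1 : nat)
    <= \sum_(0 <= c < c0) \sum_(r < M.+1) (G r c == 2 : nat).
  rewrite big_nat_cond [X in _ <= X]big_nat_cond.
  apply: leq_sum => c /andP[/andP[_ ltc] _]; rewrite [X in _ <= X]big_ord_recl.
  apply: leq_trans (leq_addl _ _); apply: leq_sum => r _; rewrite lift0.
  case: eqP => // e1.
  have in1 : inb r c by apply: filling_in; rewrite e1.
  have in2 : inb r.+1 c.
    move: in1; rewrite /in_skew; have := partition_nth_geq _ _ _ Hbeta (ltnW ltc).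
    have := ltn_ord r; rewrite -/M; lia.
  by have [_ ->] := filling_stack _ _ in1 in2.
by have := rowP M; rewrite !split_sum -eq2; lia.
Qed.

End Filling.

(** * Row contents of LR-tableaux *)

Section LR.

Variable G : filling.
Hypothesis LRG : is_LR alpha beta gamma G.

Let fG := LR_is_filling G LRG.

Lemma LR_row_le r c c' : inb r c -> inb r c' -> c <= c' -> G r c <= G r c'.
Proof.
case: LRG => _ _ _ row _ inc inc' lec; rewrite -(subnKC lec).
have : inb r (c + (c' - c)) by rewrite subnKC.
elim: (c' - c) => [|d IHd]; first by rewrite addn0.
rewrite addnS => ind1.
have ind : inb r (c + d) by move: inc ind1; rewrite !in_skewE; lia.
by apply: leq_trans (IHd ind) (row _ _ ind ind1).
Qed.

Lemma LR_row_shape r c : inb r c ->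
  (G r c == 1) = (c - conj gamma r < rcount beta G 1 r).
Proof.
move=> inc; have := inc; rewrite in_skewE => /and3P[r0 leg ltb].
have ltN := leq_trans ltb (conj_size r).
have [_ val _] := fG.
case: (val _ _ inc) => e; rewrite e /=; apply/esym.
  apply: (@leq_trans (\sum_(c' < N) ((conj gamma r <= c') && (c' < c.+1) : nat))).
    by rewrite sum_interval //; lia.
  apply: leq_sum => c' _; case: (boolP (_ && _)) => // /andP[leg' lec'].
  have inc' : inb r c' by rewrite in_skewE r0 leg' /=; lia.
  have := LR_row_le _ _ _ inc' inc lec'; rewrite e.
  by case: (val _ _ inc') => ->.
apply/negbTE; rewrite -leqNgt.
rewrite -(sum_interval N (conj gamma r) c); last by lia.
apply: leq_sum => c' _; case: eqP => // e'.
have inc' : inb r c' by apply: (filling_in _ fG); rewrite e'.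
have := inc'; rewrite in_skewE => /and3P[_ -> _] /=.
have [lec|//] := leqP c c'.
by have := LR_row_le _ _ _ inc inc' lec; rewrite e e'.
Qed.

(** A converse of [row_lattice_col]. The column condition is applied at the leftmost 2 of row
    [m.+1]; if there is none, the induction hypothesis suffices. *)
Lemma LR_row_lattice m :
  \sum_(r < m.+1) rcount beta G 2 r <= \sum_(r < m) rcount beta G 1 r.
Proof.
elim: m => [|m IHm].
  rewrite big_ord1 /rcount big1 // => c _; case: eqP => //= e.
  have : inb 0 c by apply: (filling_in _ fG); rewrite e.
  by rewrite in_skewE.
have [t0|] := posnP (rcount beta G 2 m.+1).
  by rewrite big_ord_recr /= t0 addn0 (leq_trans IHm) // big_ord_recr leq_addr.
move=> t_gt0.
have ex2 : exists c, G m.+1 c == 2.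
  have [|c _] := ltn_sum_ex N (fun=> 0) (fun c => G m.+1 c == 2 : nat).
    by rewrite big1_eq.
  by rewrite lt0b; exists c.
case: (ex_minnP ex2) => c0 /eqP e0 min0.
have in0 : inb m.+1 c0 by apply: (filling_in _ fG); rewrite e0.
have [_ lemH ltc0] := in_skew_bounds _ _ in0.
(* Nothing fits below an entry 2, so column [c0] ends here. *)
have bc0 : nth 0 beta c0 = m.+1.
  have /andP[ltg leb] : (nth 0 gamma c0 < m.+1) && (m.+1 <= nth 0 beta c0) by [].
  apply/eqP; rewrite eqn_leq leb andbT leqNgt; apply/negP => ltb.
  have in1 : inb m.+2 c0 by rewrite /in_skew; lia.
  by have [] := filling_stack _ fG _ _ in0 in1; rewrite e0.
have split_sum k n : \sum_(r < n) rcount beta G k r =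
    \sum_(0 <= c < c0) \sum_(r < n) (G r c == k : nat)
    + \sum_(c0 <= c < N) \sum_(r < n) (G r c == k : nat).
  by rewrite -big_cat_nat ?big_mkord 1?exchange_big //; apply: ltnW.
(* Columns left of [c0] reach row [m.+1], so an entry 2 higher up in them would have a box below
   it. *)
have -> : \sum_(r < m.+2) rcount beta G 2 r
    = \sum_(c0 <= c < N) \sum_(r < m.+2) (G r c == 2 : nat).
  rewrite split_sum big_nat_cond big1 // => c /andP[/andP[_ ltc] _].
  rewrite big1 // => r _; case: eqP => // e.
  have [lt_r|ge_r] := ltnP r m.+1; last first.
    have er : nat_of_ord r = m.+1 by have := ltn_ord r; lia.
    by have := min0 c; rewrite -er e eqxx => /(_ isT); lia.
  have inr : inb r c by apply: (filling_in _ fG); rewrite e.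
  have inr1 : inb r.+1 c.
    move: inr; rewrite /in_skew; have := partition_nth_geq _ _ _ Hbeta (ltnW ltc).
    by rewrite bc0; lia.
  by have [] := filling_stack _ fG _ _ inr inr1; rewrite e.
apply: (@leq_trans (ccount_from beta G 2 c0)).
  apply: leq_sum => c _; rewrite -!(big_mkord xpredT (fun r => G r c == 2 : nat)).
  by rewrite [X in _ <= X](@big_cat_nat _ _ _ m.+2) //= ?leq_addr //; lia.
have [_ _ _ _ [_ /(_ c0) colP]] := LRG.
apply: leq_trans colP _; rewrite split_sum.
apply: leq_trans (leq_addl _ _); rewrite /ccount_from.
rewrite big_nat_cond [X in _ <= X]big_nat_cond.
apply: leq_sum => c /andP[/andP[lec _] _].
rewrite -!(big_mkord xpredT (fun r => G r c == 1 : nat)).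
(* From [c0] on, columns end in row [m.+1] at the latest and that row contains only entries 2, so
   all entries 1 lie above it. *)
rewrite [X in X <= _](@big_cat_nat _ _ _ m.+1) //=; last by lia.
rewrite -[X in _ <= X]addn0 leq_add2l leqn0; apply/eqP.
rewrite big_nat_cond; apply: big1.
move=> r /andP[/andP[ler _] _]; case: eqP => // e.
have inr : inb r c by apply: (filling_in _ fG); rewrite e.
have er : r = m.+1.
  move: inr; rewrite /in_skew; have := partition_nth_geq _ _ _ Hbeta lec; lia.
by subst r; have := LR_row_le _ _ _ in0 inr lec; rewrite e e0.
Qed.

End LR.

Lemma LR_rcount_inj G G' : is_LR alpha beta gamma G -> is_LR alpha beta gamma G' ->
  (forall r, rcount beta G 1 r = rcount beta G' 1 r) -> forall r c, G r c = G' r c.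
Proof.
move=> LRG LRG' eqr r c.
have [inc|out] := boolP (inb r c); last first.
  by case: LRG => -> // *; case: LRG' => ->.
have [_ val _] := LR_is_filling _ LRG; have [_ val' _] := LR_is_filling _ LRG'.
have := LR_row_shape _ LRG r c inc; rewrite eqr -(LR_row_shape _ LRG') //.
by case: (val _ _ inc) => ->; case: (val' _ _ inc) => ->.
Qed.

(** * Realization of an admissible diagram by a Klein tableau *)

Section Realization.

Variable D : arcdiag.
Hypothesis aD : admissible H stack_size row_size (conj alpha 2) D.
Hypothesis size_alpha : \sum_(r < H.+1) row_size r = conj alpha 1 + conj alpha 2.

Let ones r := hits H D r + D.2 r.

Let labels m : seq nat :=
  flatten [seq nseq (D.1 m r) r | r <- iota 0 m.-1] ++ nseq (D.1 m m.-1) m.-1.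

(* Row [r] reads 1 ... 1 followed by its entries 2 with increasing subscripts,
   so the entries below a 1, at the right end, carry the subscript [r - 1]. *)
Let K : kfilling := fun r c =>
  if inb r c then
    if c < conj gamma r + ones r then (1, 0)
    else (2, nth 0 (labels r) (c - (conj gamma r + ones r)))
  else (0, 0).

Let sD : supported H D. Proof. by case: aD. Qed.

Let D_out m y : m <= y -> D.1 m y = 0.
Proof. by move=> le; apply/eqP; rewrite -leqn0 leqNgt; apply/negP => /sD[]; lia. Qed.

Let count_labels m (y : nat) : count_mem y (labels m) = D.1 m y.
Proof.
have count_flat s : count_mem y (flatten [seq nseq (D.1 m r) r | r <- s])
    = count_mem y s * D.1 m y.
  elim: s => //= r s IHs; rewrite count_cat count_nseq IHs mulnDl /=.
  by case: eqP => [->|].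
rewrite count_cat count_flat count_nseq count_uniq_mem ?iota_uniq // mem_iota add0n /=.
have [->|m0] := posnP m; first by rewrite !D_out //= !muln0.
have [ltym|leym] := ltnP y m; last by rewrite (D_out m y) //; lia.
have [e|ne] := eqVneq m.-1 y; first by rewrite /= e ltnn mul1n.
by rewrite (_ : y < m.-1) ?mul1n ?addn0 //; lia.
Qed.

Let labels_mem m y : y \in labels m -> 0 < D.1 m y.
Proof. by rewrite -count_labels -has_count has_pred1. Qed.

Let size_labels m : size (labels m) = twos H D m.
Proof.
have size_count s n : all (fun y => y < n) s -> size s = \sum_(y < n) count_mem (val y) s.
  elim: s => [|x s IHs] /=; first by rewrite big1_eq.
  move=> /andP[ltx /IHs ->]; rewrite big_split /= -add1n; congr (_ + _).
  by under eq_bigr do rewrite eq_sym; rewrite sum_ord_eq ltx.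
rewrite (size_count _ H.+1); first by apply: eq_bigr => y _; apply: count_labels.
by apply/allP => y /labels_mem/sD[]; lia.
Qed.

Let row_split r : 0 < r ->
  conj gamma r + ones r + size (labels r) = conj beta r.
Proof.
move=> r0; rewrite size_labels; case: aD => _ _ tot _; have := tot r.
by rewrite row_sizeE // /ones; have := conj_sub r r0; lia.
Qed.

Let row0 : ones 0 = 0.
Proof.
case: aD => _ _ tot _; have := tot 0; have := row_size_bounds 0.
by rewrite /ones; lia.
Qed.

Let sum_nth (s : seq nat) y n lo : lo + size s <= n ->
  \sum_(c < n) ([&& lo <= c, c < lo + size s & nth 0 s (c - lo) == y] : nat)
  = count_mem y s.
Proof.
elim: s lo => [|x s IHs] lo /= len; first by rewrite big1 // => c _; lia.
rewrite -(IHs lo.+1); last by lia.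
have one : \sum_(c < n) (val c == lo : nat) = 1 by rewrite sum_ord_eq (_ : lo < n) //; lia.
transitivity (\sum_(c < n) ((c == lo :> nat) * (x == y : nat)
    + [&& lo < c, c < lo.+1 + size s & nth 0 s (c - lo.+1) == y])); last first.
  by rewrite big_split -big_distrl /= one mul1n.
apply: eq_bigr => c _.
have [ltc|ltc|->] := ltngtP (c : nat) lo.
- by lia.
- by rewrite (_ : c - lo = (c - lo.+1).+1) /= ?mul0n ?addSn ?addnS //; lia.
- by rewrite subnn mul1n addn0 (_ : lo < lo + (size s).+1) //; lia.
Qed.

Let K_two r c (y : nat) : (K r c == (2, y)) =
  (0 < r) && [&& conj gamma r + ones r <= c,
    c < conj gamma r + ones r + size (labels r)
    & nth 0 (labels r) (c - (conj gamma r + ones r)) == y].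
Proof.
rewrite /K in_skewE; case: (posnP r) => //= r0; rewrite row_split //.
case: (leqP (conj gamma r + ones r) c) => [leoc|ltco] /=.
  have -> /= : conj gamma r <= c by lia.
  by case: ifP => //; rewrite xpair_eqE eqxx.
by case: ifP.
Qed.

Let K_one r c : ((K r c).1 == 1) =
  (conj gamma r <= c) && (c < conj gamma r + ones r).
Proof.
rewrite /K in_skewE; case: (posnP r) => [->|r0] /=; first by rewrite row0; lia.
by have := row_split r r0; case: ifP; [case: ifP|]; rewrite /=; lia.
Qed.

Let K_1_0 r c : (K r c).1 != 2 -> (K r c).2 = 0.
Proof. by rewrite /K; do 2?case: ifP. Qed.

Let K_lab m c : (K m c).1 = 2 ->
  [/\ 0 < m, K m c = (2, (K m c).2) & 0 < D.1 m (K m c).2].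
Proof.
move=> e; have eK : K m c = (2, (K m c).2) by rewrite -e; case: (K m c).
have := K_two m c (K m c).2; rewrite -eK eqxx => /esym/and4P[m0 le lt /eqP eL].
by split=> //; rewrite -eL; apply: labels_mem; apply: mem_nth; rewrite ltn_subLR.
Qed.

Let arcsK m r : (kdiag beta K).1 m r = D.1 m r.
Proof.
rewrite /= -count_labels; have [->|m0] := posnP m.
  by rewrite count_labels D_out // big1.
rewrite -(sum_nth (labels m) r N (conj gamma m + ones m)); last first.
  by rewrite row_split // conj_size.
by apply: eq_bigr => c _; rewrite K_two m0.
Qed.

Let rcountK1 r : rcount beta (kunder K) 1 r = ones r.
Proof.
rewrite /rcount /kunder; have [->|r0] := posnP r.
  by rewrite row0 big1 // => c _; rewrite K_one row0; lia.
transitivity (conj gamma r + ones r - conj gamma r); last by rewrite addKn.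
rewrite -(sum_interval N).
  by apply: eq_bigr => c _; rewrite K_one.
by have := row_split r r0; have := conj_size r; lia.
Qed.

Let hitsK r : count2s beta K r = hits H D r.
Proof. by apply: eq_bigr => m _; rewrite -arcsK. Qed.

Let fK : LR_filling (kunder K).
Proof.
split=> [r c|r c|r c]; rewrite /kunder.
- by rewrite /K => /negbTE->.
- by rewrite /K => ->; case: ifP; [left|right].
move=> in1 in2; have r0 : 0 < r by have [] := in_skew_bounds _ _ in1.
(* The boxes of row [r.+1] with a box above number at most [D.1 r.+1 r], hence at most the entries 1
   of row [r] and the entries 2 of row [r.+1]. So they lie under the initial run of 1s and in the
   final run of 2s. *)
have [_ kD _ _] := aD; have := kD r.+1; rewrite stack_sizeE //= => le_k.
have le_hit : D.1 r.+1 r <= hits H D r.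
  have [_ ltH _] := in_skew_bounds _ _ in2.
  by rewrite /hits (bigD1 (Ordinal (ltH : r.+1 < H.+1))) //= leq_addr.
have le_two : D.1 r.+1 r <= size (labels r.+1).
  by rewrite size_cat size_nseq leq_addl.
have -> : (K r c).1 = 1.
  apply/eqP; rewrite K_one; move: in1 in2; rewrite !in_skewE /ones; lia.
rewrite /K in2; case: ifP => // lt.
by have := row_split r.+1 isT; move: in1 in2; rewrite !in_skewE; lia.
Qed.

Let rcountK2 r : rcount beta (kunder K) 2 r = twos H D r.
Proof.
have := rcount_12 _ fK r; rewrite rcountK1; case: aD => _ _ /(_ r) <- _.
by rewrite /ones; lia.
Qed.

Let sum_supp_le a n (f : nat -> nat) : (forall y, 0 < f y -> y < n) ->
  \sum_(y < a) f y <= \sum_(y < n) f y.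
Proof.
move=> supp; rewrite -!(big_mkord xpredT f); have [lean|/ltnW lena] := leqP a n.
  by rewrite [X in _ <= X](@big_cat_nat _ _ _ a) //= leq_addr.
rewrite (@big_cat_nat _ _ _ n) //= -[X in _ <= X]addn0 leq_add2l leqn0.
rewrite big_nat_cond big1 // => y /andP[/andP[ley _] _].
by apply/eqP; rewrite -leqn0 leqNgt; apply/negP => /supp; lia.
Qed.

Lemma realize_diagram :
  exists K, is_klein alpha beta gamma K /\ diag_eq (kdiag beta K) D.
Proof.
exists K; split; last first.
  by split=> [|r] //=; rewrite rcountK1 hitsK /ones addKn.
have [_ kD tot eqb] := aD.
have eq2 : tcount beta (kunder K) 2 = conj alpha 2.
  by rewrite -eqb; apply: eq_bigr => r _; rewrite -rcountK2.
split=> //.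
- have [out val col] := fK; split=> //.
  + by split=> //; have := sum_row_size _ fK; rewrite size_alpha eq2; lia.
  + move=> r c inc inc1.
    have := K_one r c; have := K_one r c.+1; rewrite -/(kunder K r c) -/(kunder K r c.+1).
    by case: (val _ _ inc) => ->; case: (val _ _ inc1) => -> //=;
      move: inc; rewrite in_skewE; lia.
  (* Each 2 in the rows up to [m] is the right end of an arc whose left end is a 1 above row [m];
     counting arcs gives the lattice condition. *)
  + split=> //; apply: row_lattice_col => // m.
    under eq_bigr do rewrite rcountK2; under [X in _ <= X]eq_bigr do rewrite rcountK1.
    apply: (@leq_trans (\sum_(r < m.+1) \sum_(y < m) D.1 r y)).
      by apply: leq_sum => r _; apply: sum_supp_le => y /sD[]; have := ltn_ord r; lia.
    rewrite exchange_big /=; apply: leq_sum => y _; apply: leq_trans (leq_addr _ _).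
    by apply: (sum_supp_le m.+1 H.+1 (D.1^~ y)) => r /sD[].
- by move=> m c /K_lab[_ _ /sD[]]; lia.
- move=> m c e2 e1; have [m0 _ _] := K_lab _ _ e2.
  have in1 : inb m.-1 c by apply: (filling_in _ fK); rewrite /kunder e1.
  have [m1 _ _] := in_skew_bounds _ _ in1.
  case: m m0 e2 e1 in1 m1 => //= m _ e2 _ in1 m1.
  have := K_two m.+1 c (K m.+1 c).2.
  have [_ eK _] := K_lab _ _ e2; rewrite -eK eqxx => /esym/and4P[_ leo lt /eqP <-].
  (* A box below a 1 is among the last [stack_size m.+1] of its row, where [labels] has its final
     block of labels [m]. *)
  have := kD m.+1; rewrite stack_sizeE //= => le_k.
  have := row_split m.+1 isT; move: in1 lt; rewrite in_skewE nth_cat nth_nseq.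
  rewrite size_cat size_nseq /=; set S := size _; move: S => S in1 lt split_m.
  by rewrite ifF ?ifT //; lia.
- by move=> s; rewrite hitsK rcountK1 leq_addr.
Qed.

End Realization.

(** * Diagrams of Klein tableaux *)

Lemma klein_in K r c : is_klein alpha beta gamma K -> 0 < (K r c).1 -> inb r c.
Proof. by case=> /LR_is_filling fK _ _ _ _; apply: (filling_in _ fK). Qed.

Lemma klein_subscript K m c s : is_klein alpha beta gamma K -> K m c = (2, s) ->
  [/\ 0 < s, s < m, m <= H & c < N].
Proof.
move=> kK e; have inc : inb m c by apply: (klein_in K) => //; rewrite e.
have [m0 leH ltN] := in_skew_bounds _ _ inc.
by case: kK => _ _ /(_ m c); rewrite e /= => /(_ erefl) ? _ _; split=> //; lia.
Qed.

Lemma twos_kdiag K : is_klein alpha beta gamma K ->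
  forall m, twos H (kdiag beta K) m = rcount beta (kunder K) 2 m.
Proof.
move=> kK m; rewrite /twos exchange_big /=; apply: eq_bigr => c _.
rewrite /kunder; case eK: (K m c) => [e s] /=.
under eq_bigr do rewrite xpair_eqE; case: eqP => [e2|_]; last by rewrite big1_eq.
rewrite e2 in eK; have [_ ltsm lemH _] := klein_subscript K m c s kK eK.
by under eq_bigr do rewrite eq_sym; rewrite sum_ord_eq (_ : s < H.+1) //; lia.
Qed.

Lemma ones_kdiag K : is_klein alpha beta gamma K ->
  forall r, hits H (kdiag beta K) r + (kdiag beta K).2 r = rcount beta (kunder K) 1 r.
Proof. by case=> _ _ _ _ le r; rewrite /= subnKC //; apply: le. Qed.

Lemma arc_of_kdiag K m r : 0 < (kdiag beta K).1 m r -> exists c, K m c = (2, r).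
Proof.
move=> gt0; have [|c _] := ltn_sum_ex N (fun=> 0) (fun c => K m c == (2, r) : nat).
  by rewrite big1_eq.
by rewrite lt0b => /eqP e; exists c.
Qed.

Lemma klein_admissible K : is_klein alpha beta gamma K ->
  admissible H stack_size row_size (conj alpha 2) (kdiag beta K).
Proof.
move=> kK; have [LRK _ _ stk _] := kK; have fK := LR_is_filling _ LRK; split.
- by move=> m r /arc_of_kdiag[c /(klein_subscript _ _ _ _ kK)[]].
- move=> m; apply: leq_sum => c _; case: (boolP (_ && _)) => // /andP[inm inm1].
  have [m0 _ _] := in_skew_bounds _ _ inm; case: m m0 inm inm1 => // m _ inm inm1.
  have [e1 e2] := filling_stack _ fK _ _ inm1 inm.
  have <- := stk _ _ e2 e1; rewrite /kunder in e2.
  by rewrite -e2 -surjective_pairing eqxx.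
- move=> x; rewrite -addnA twos_kdiag // ones_kdiag // addnC.
  exact: rcount_12.
- under eq_bigr do rewrite twos_kdiag //.
  by case: LRK => _ _ [].
Qed.

Lemma sum_row_size_LR G : is_LR alpha beta gamma G ->
  \sum_(r < H.+1) row_size r = conj alpha 1 + conj alpha 2.
Proof.
by move=> LRG; rewrite (sum_row_size _ (LR_is_filling _ LRG)); case: LRG => _ _ [-> ->].
Qed.

(** Row counts determine an LR-tableau, so prescribing the right ends makes the realization refine
    [G]. *)
Lemma realize_refining G D : is_LR alpha beta gamma G ->
  admissible H stack_size row_size (conj alpha 2) D ->
  (forall x, twos H D x = rcount beta G 2 x) ->
  exists K, klein_of alpha beta gamma G K /\ kdiag beta K = D.
Proof.
move=> LRG aD eq2; have [K [kK /diag_eqP eqD]] := realize_diagram _ aD (sum_row_size_LR _ LRG).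
exists K; split=> //; split=> //; have [LRK _ _ _ _] := kK.
apply: (LR_rcount_inj (kunder K)) => // r.
rewrite -ones_kdiag // eqD; have := rcount_12 _ (LR_is_filling _ LRG) r.
by case: aD => _ _ /(_ r) <- _; rewrite eq2; lia.
Qed.

Lemma klein_exists G : is_LR alpha beta gamma G ->
  exists K, klein_of alpha beta gamma G K.
Proof.
move=> LRG; have fG := LR_is_filling _ LRG.
have tot := rcount_12 _ fG.
have [||||D [sD kD eq2 eq1]] := fifo_diagram H stack_size (rcount beta G 1) (rcount beta G 2) _ _ _ _ (LR_row_lattice _ LRG).
- by have := tot 0; have := row_size_bounds 0; lia.
- by move=> m; have := tot m; have := row_size_bounds m; lia.
- move=> m; apply: leq_sum => c _; case: (boolP (_ && _)) => // /andP[inm inm1].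
  have [m0 _ _] := in_skew_bounds _ _ inm; case: m m0 inm inm1 => // m _ inm inm1.
  by have [_ ->] := filling_stack _ fG _ _ inm1 inm.
- move=> m; apply: leq_sum => c _; case: (boolP (_ && _)) => // /andP[inm1 inm].
  by have [-> _] := filling_stack _ fG _ _ inm inm1.
have aD : admissible H stack_size row_size (conj alpha 2) D.
  split=> // [x|]; first by rewrite -addnA eq1 eq2 addnC tot.
  by under eq_bigr do rewrite eq2; case: LRG => _ _ [].
by have [K [kK _]] := realize_refining _ _ LRG aD eq2; exists K.
Qed.

Lemma klein_of_twos G K : klein_of alpha beta gamma G K ->
  forall x, twos H (kdiag beta K) x = rcount beta G 2 x.
Proof.
move=> [kK eqG] x; rewrite twos_kdiag //.
by apply: eq_bigr => c _; rewrite /kunder eqG.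
Qed.

(** * Minimal and maximal elements *)

Lemma minimal_no_cross G P : is_LR alpha beta gamma G ->
  minimal_in beta (klein_of alpha beta gamma G) P -> no_cross (kdiag beta P).
Proof.
move=> LRG [[kP eqG] minP]; have aP := klein_admissible _ kP.
apply: (no_move_no_cross _ _ _ _ _ aP) => D' mv aD' eq2.
have [K [kK eqK]] : exists K, klein_of alpha beta gamma G K /\ kdiag beta K = D'.
  by apply: realize_refining => // x; rewrite eq2; apply: klein_of_twos.
have /diag_eqP e : diag_eq (kdiag beta K) (kdiag beta P).
  apply: minP => //; rewrite /arc_le eqK.
  by apply: arc_reach_step mv _; apply: arc_reach_refl.
have [sP _ _ _] := aP; have [_] := arc_move_weight _ _ _ sP mv.
by rewrite -eqK e ltnn.
Qed.

Lemma maximal_no_unmove (S : kfilling -> Prop) P K :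
  (forall K, S K -> is_klein alpha beta gamma K) ->
  maximal_in beta S P -> S K -> ~ arc_move (kdiag beta K) (kdiag beta P).
Proof.
move=> Skl [SP maxP] SK mv.
have /diag_eqP e : diag_eq (kdiag beta K) (kdiag beta P).
  by apply: maxP => //; apply: arc_reach_step mv _; apply: arc_reach_refl.
have [sK _ _ _] := klein_admissible _ (Skl _ SK).
by have [_] := arc_move_weight _ _ _ sK mv; rewrite e ltnn.
Qed.

Lemma maximal_all_cross G P : is_LR alpha beta gamma G ->
  maximal_in beta (klein_of alpha beta gamma G) P ->
  all_cross stack_size (kdiag beta P).
Proof.
move=> LRG maxP; have [[kP eqG] _] := maxP.
apply: (no_unmove_all_cross _ _ _ _ _ row_size_bounds (klein_admissible _ kP)) => D' mv aD' eq2.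
have [K [kK eqK]] : exists K, klein_of alpha beta gamma G K /\ kdiag beta K = D'.
  by apply: realize_refining => // x; rewrite eq2; apply: klein_of_twos.
by apply: (maximal_no_unmove _ P K _ maxP kK); [move=> ? [] | rewrite eqK].
Qed.

(** When the LR-tableau may vary, every admissible predecessor is realized, so the inverses of all
    four moves are ruled out. *)
Lemma maximal_klein P : maximal_in beta (is_klein alpha beta gamma) P ->
  all_cross stack_size (kdiag beta P) /\ all_overlap stack_size (kdiag beta P).
Proof.
move=> maxP; have [kP _] := maxP; have aP := klein_admissible _ kP.
have no_unmove D' : arc_move D' (kdiag beta P) ->
    ~ admissible H stack_size row_size (conj alpha 2) D'.
  move=> mv aD'; have [LRP _ _ _ _] := kP.
  have [K [kK /diag_eqP eqK]] := realize_diagram _ aD' (sum_row_size_LR _ LRP).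
  by apply: (maximal_no_unmove _ P K _ maxP kK); rewrite ?eqK.
split.
- by apply: (no_unmove_all_cross _ _ _ _ _ row_size_bounds aP) => D' mv aD' _; apply: no_unmove mv aD'.
- by apply: (no_unmove_all_overlap _ _ _ _ _ row_size_bounds aP) => D' mv aD'; apply: no_unmove mv aD'.
Qed.

Lemma maximal_exists (S : kfilling -> Prop) :
  (forall K, S K -> is_klein alpha beta gamma K) -> (exists K, S K) ->
  exists P, maximal_in beta S P.
Proof.
move=> Skl exS.
have [|P [SP maxP]] := bounded_max _ S (fun K => weight H (kdiag beta K))
  (\sum_(x < H.+1) \sum_(y < H.+1) N * arc_weight H x y) exS.
  (* Multiplicities of arcs count columns, so weights are bounded; a tableau of largest weight is
     maximal. *)
  move=> K _; apply: leq_sum => x _; apply: leq_sum => y _; apply: leq_mul => //.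
  by rewrite -[X in _ <= X]card_ord -sum1_card; apply: leq_sum => c _; case: eqP.
exists P; split=> // P' SP' reach.
have [sP' _ _ _] := klein_admissible _ (Skl _ SP').
by case: (arc_reach_weight _ _ _ sP' reach) => // ; have := maxP _ SP'; lia.
Qed.

Lemma unique_maximal_refining G : is_LR alpha beta gamma G ->
  unique_maximal beta (klein_of alpha beta gamma G).
Proof.
move=> LRG.
have [|P maxP] := maximal_exists (klein_of alpha beta gamma G) _ (klein_exists _ LRG).
  by move=> K [].
exists P; split=> // P' maxP'; have [KP _] := maxP; have [KP' _] := maxP'.
have [kP _] := KP; have [kP' _] := KP'.
have [sP kdP tot _] := klein_admissible _ kP.
have [sP' kdP' tot' _] := klein_admissible _ kP'.
have eq2 x : twos H (kdiag beta P') x = twos H (kdiag beta P) x.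
  by rewrite !(klein_of_twos G).
apply: (all_cross_unique H stack_size) => //; try exact: (maximal_all_cross G).
by move=> y; have := tot y; rewrite -(tot' y) eq2; lia.
Qed.

Lemma unique_maximal_klein : (exists G, is_LR alpha beta gamma G) ->
  unique_maximal beta (is_klein alpha beta gamma).
Proof.
move=> [G LRG]; have [K0 [kK0 _]] := klein_exists _ LRG.
have [//||P maxP] := maximal_exists (is_klein alpha beta gamma); first by exists K0.
exists P; split=> // P' maxP'; have [kP _] := maxP; have [kP' _] := maxP'.
have [acP aoP] := maximal_klein _ maxP; have [acP' aoP'] := maximal_klein _ maxP'.
have [sP kdP tot eqb] := klein_admissible _ kP.
have [sP' kdP' tot' eqb'] := klein_admissible _ kP'.
apply: (extremal_unique H stack_size) => // [x|]; first by rewrite tot tot'.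
by rewrite eqb eqb'.
Qed.

(** * Relabelling and the dominant tableau *)

Definition relabel (K : kfilling) m c s : kfilling :=
  fun x y => if (x == m) && (y == c) then (2, s) else K x y.

Lemma relabel_count K m c r s y : m <= H -> c < N -> K m c = (2, r) ->
  count2s beta (relabel K m c s) y + (r == y) = count2s beta K y + (s == y).
Proof.
move=> lemH ltcN e.
rewrite -(sum2_ind2 H.+1 N (fun _ _ => r == y : nat) m c) //.
rewrite -(sum2_ind2 H.+1 N (fun _ _ => s == y : nat) m c) //.
rewrite -!big_split /=; apply: eq_bigr => x _; rewrite -!big_split /=.
apply: eq_bigr => z _; rewrite /relabel /ind2.
by case: (x =P m :> nat) => [->|_]; case: (z =P c :> nat) => [->|_];
  rewrite /= ?addn0 // e !xpair_eqE !eqxx !mul1n addnC.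
Qed.

(** Leaves out the count of subscripts, which may fail between the two relabellings that make up a
    move. *)
Definition preklein K :=
  [/\ is_LR alpha beta gamma (kunder K),
      (forall r c, (K r c).1 != 2 -> (K r c).2 = 0),
      (forall m c, (K m c).1 = 2 -> 1 <= (K m c).2 <= m.-1)
    & (forall m c, (K m c).1 = 2 -> (K m.-1 c).1 = 1 -> (K m c).2 = m.-1)].

Lemma relabel_entry K m c r s : K m c = (2, r) ->
  forall x y, (relabel K m c s x y).1 = (K x y).1.
Proof. by move=> e x y; rewrite /relabel; case: ifP => // /andP[/eqP-> /eqP->]; rewrite e. Qed.

(** The old label [r < m.-1] shows that the box above does not contain 1, so any positive subscript
    below [m] is allowed. *)
Lemma relabel_preklein K m c r s : preklein K -> K m c = (2, r) ->
  r < m.-1 -> 0 < s < m -> preklein (relabel K m c s).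
Proof.
move=> [LRK K0 Krange Kstack] e ltr lts; have eq1 := relabel_entry _ _ _ _ s e.
split.
- suff -> : kunder (relabel K m c s) = kunder K by [].
  by do 2!apply: functional_extensionality => ?; apply: eq1.
- by move=> x y; rewrite eq1 /relabel; case: ifP => [/andP[/eqP-> /eqP->]|_ /K0 //]; rewrite e.
- move=> x y; rewrite eq1 /relabel; case: ifP => [/andP[/eqP-> _] _ /=|_ /Krange //]; lia.
- move=> x y; rewrite !eq1 /relabel; case: ifP => [/andP[/eqP-> /eqP->]|_]; last exact: Kstack.
  by move=> /Kstack s2 /s2; rewrite e /=; lia.
Qed.

Lemma klein_preklein K : is_klein alpha beta gamma K -> preklein K.
Proof. by case. Qed.

Lemma preklein_klein K : preklein K ->
  (forall s, count2s beta K s <= rcount beta (kunder K) 1 s) ->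
  is_klein alpha beta gamma K.
Proof. by case. Qed.

(* An available move could be performed inside the filling by exchanging
   labels, which would raise the label of the upper (or only) box involved. *)
Lemma dominant_no_cross G D : is_dominant alpha beta gamma G D ->
  no_cross (kdiag beta D).
Proof.
move=> [[kD eqG] dom]; have pD := klein_preklein _ kD.
have le_count : forall s, count2s beta D s <= rcount beta (kunder D) 1 s by case: kD.
split.
- move=> m n r s ltsr ltrn ltnm /arc_of_kdiag[c2 e2] /arc_of_kdiag[c1 e1].
  have [r0 ltrm lemH ltc2] := klein_subscript _ _ _ _ kD e2.
  have [s0 ltsn lenH ltc1] := klein_subscript _ _ _ _ kD e1.
  (* [K2] is the result of (A). As [n < m], the box [(n, c1)] is the first one changed, and its
     label rises from [s] to [r]. *)
  pose K1 := relabel D n c1 r; pose K2 := relabel K1 m c2 s.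
  have e12 : K1 m c2 = (2, r) by rewrite /K1 /relabel ifF //; lia.
  have eqK2 x y : (K2 x y).1 = (D x y).1.
    by rewrite (relabel_entry _ _ _ _ _ e12) (relabel_entry _ _ _ _ _ e1).
  have kK2 : klein_of alpha beta gamma G K2.
    split=> [|x y]; last by rewrite eqK2 eqG.
    apply: preklein_klein => [|y].
      apply: (relabel_preklein _ _ _ _ _ _ e12); try lia.
      by apply: (relabel_preklein _ _ _ _ _ pD e1); lia.
    rewrite (_ : rcount _ _ 1 y = rcount beta (kunder D) 1 y); last first.
      by apply: eq_bigr => c _; rewrite /kunder eqK2.
    have := relabel_count _ _ _ _ s y lemH ltc2 e12.
    have := relabel_count _ _ _ _ r y lenH ltc1 e1.
    by rewrite -/K1 -/K2; have := le_count y; lia.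
  have := dom n c1 _ K2 kK2 _; rewrite -eqG e1 => /(_ erefl) le_rs.
  suff : r <= s by lia.
  have -> : r = (K2 n c1).2.
    by rewrite /K2 /relabel ifF ?/K1 /relabel ?eqxx //; lia.
  apply: le_rs => x y lt; rewrite /K2 /K1 /relabel !ifF //; lia.
- move=> m r s ltsr ltrm /arc_of_kdiag[c e] pole.
  have [s0 ltsm lemH ltc] := klein_subscript _ _ _ _ kD e.
  (* This is (B); the pole at [r] leaves room for one more subscript [r]. *)
  pose K1 := relabel D m c r.
  have eqK1 x y : (K1 x y).1 = (D x y).1 by rewrite (relabel_entry _ _ _ _ _ e).
  have kK1 : klein_of alpha beta gamma G K1.
    split=> [|x y]; last by rewrite eqK1 eqG.
    apply: preklein_klein => [|y].
      by apply: (relabel_preklein _ _ _ _ _ pD e); lia.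
    rewrite (_ : rcount _ _ 1 y = rcount beta (kunder D) 1 y); last first.
      by apply: eq_bigr => c' _; rewrite /kunder eqK1.
    have := relabel_count _ _ _ _ r y lemH ltc e; rewrite -/K1.
    have := le_count y; move: pole; rewrite /=; case: (r =P y) => [->|_]; lia.
  have := dom m c _ K1 kK1 _; rewrite -eqG e => /(_ erefl) le_rs.
  suff : r <= s by lia.
  have -> : r = (K1 m c).2 by rewrite /K1 /relabel !eqxx.
  apply: le_rs => x y lt; rewrite /K1 /relabel !ifF //; lia.
Qed.

(** Boxes are numbered row by row. Having settled the boxes before [n], the construction picks,
    among the refinements that agree on them, one with the largest label at [n]; optimality at
    earlier boxes persists, as it depends only on labels up to them. *)
Lemma dominant_exists G : is_LR alpha beta gamma G ->
  exists D, is_dominant alpha beta gamma G D.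
Proof.
move=> LRG; pose box (K : kfilling) i := K (i %/ N) (i %% N).
pose best K i := forall K', klein_of alpha beta gamma G K' ->
  (forall j, j < i -> box K' j = box K j) -> (box K' i).2 <= (box K i).2.
have greedy n : exists K, klein_of alpha beta gamma G K /\
    forall i, i < n -> best K i.
  elim: n => [|n [K [kK bestK]]].
    by have [K kK] := klein_exists _ LRG; exists K.
  have [||K1 [[kK1 agree1] max1]] := bounded_max _
    (fun K' => klein_of alpha beta gamma G K' /\ forall j, j < n -> box K' j = box K j)
    (fun K' => (box K' n).2) n.
  - by exists K.
  - move=> K' [[[_ K0 Krange _ _] _] _]; rewrite /box.
    have [/Krange|/K0->//] := eqVneq (K' (n %/ N) (n %% N)).1 2.
    by have := leq_div n N; lia.
  exists K1; split=> // i; rewrite ltnS leq_eqVlt => /predU1P[->|lti].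
    move=> K' kK' agree; apply: max1; split=> // j ltj.
    by rewrite agree // agree1.
  move=> K' kK' agree; rewrite agree1 //; apply: bestK => // j ltj.
  by rewrite agree // agree1 //; lia.
have [D [kD bestD]] := greedy (H.+1 * N).
exists D; split=> // r c e K kK agree.
have inc : inb r c by apply: (filling_in _ (LR_is_filling _ LRG)); rewrite e.
have [r0 leH ltN] := in_skew_bounds _ _ inc.
have Npos : 0 < N by lia.
have er : (r * N + c) %/ N = r by rewrite divnMDl // divn_small // addn0.
have ec : (r * N + c) %% N = c by rewrite modnMDl modn_small.
have := bestD (r * N + c) _ K kK _; rewrite /box er ec; apply.
  by apply: (@leq_trans (r.+1 * N)); [rewrite mulSn; lia | rewrite leq_mul2r; lia].
move=> j ltj; apply: agree; have := divn_eq j N; have := ltn_mod j N; rewrite Npos.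
move: (j %/ N) (j %% N) => q t ltt ej.
have [//|ltrq|eqr] := ltngtP q r.
  have : r.+1 * N <= q * N by rewrite leq_mul2r ltrq orbT.
  by rewrite mulSn; lia.
by rewrite /=; move: ltj; rewrite ej eqr ltn_add2l.
Qed.

End Tableaux.

(** * Assembly of the four statements on extremal elements *)

Theorem theorem5p6 (alpha beta gamma : seq nat)
  (Halpha : is_partition alpha) (Hbeta : is_partition beta)
  (Hgamma : is_partition gamma)
  (Hsub : forall c, nth 0 gamma c <= nth 0 beta c)
  (Halpha1 : nth 0 alpha 0 <= 2) :
  (* (1) *)
  (forall G : filling, is_LR alpha beta gamma G ->
     (exists D, is_dominant alpha beta gamma G D) /\
     forall D, is_dominant alpha beta gamma G D ->
       minimal_in beta (klein_of alpha beta gamma G) D /\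
       forall P, minimal_in beta (klein_of alpha beta gamma G) P ->
         diag_eq (kdiag beta P) (kdiag beta D)) /\
  (* (2) *)
  (forall G : filling, is_LR alpha beta gamma G ->
     unique_maximal beta (klein_of alpha beta gamma G)) /\
  (* (3) *)
  ((exists G : filling, is_LR alpha beta gamma G) ->
     unique_maximal beta (is_klein alpha beta gamma)) /\
  (* (4) *)
  (forall P : kfilling,
     minimal_in beta (is_klein alpha beta gamma) P <->
     exists G : filling, is_LR alpha beta gamma G /\
       minimal_in beta (klein_of alpha beta gamma G) P).
Proof.
split; [|split; [|split]].
- move=> G LRG; split=> [|D domD]; first exact: dominant_exists.
  have ncD := dominant_no_cross _ _ _ Hbeta Hgamma _ _ domD; have [KD _] := domD.
  split=> [|P minP]; first exact: no_cross_minimal.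
  have ncP := minimal_no_cross _ _ _ Hbeta Hgamma Hsub _ _ LRG minP.
  have [KP _] := minP; have [kP _] := KP; have [kD _] := KD.
  have [sP _ tot _] := klein_admissible _ _ _ Hbeta Hgamma _ kP.
  have [sD _ tot' _] := klein_admissible _ _ _ Hbeta Hgamma _ kD.
  have eq2 x : twos (bH beta) (kdiag beta P) x = twos (bH beta) (kdiag beta D) x.
    by rewrite !(klein_of_twos alpha beta gamma Hbeta Hgamma G).
  apply: (no_cross_unique (bH beta)) => // y.
  by have := tot y; rewrite -(tot' y) eq2; lia.
- by move=> G; apply: unique_maximal_refining.
- exact: unique_maximal_klein.
(* Minimality passes to the smaller poset of refinements of the underlying LR-tableau. Conversely, a
   minimal refinement has no crossings, so no move of any kind applies to it. *)
- move=> P; split=> [[kP minP]|[G [LRG minP]]].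
    exists (kunder P); have [LRP _ _ _ _] := kP; split=> //.
    by split=> // P' [kP' _]; apply: minP.
  have ncP := minimal_no_cross _ _ _ Hbeta Hgamma Hsub _ _ LRG minP.
  by have [[kP _] _] := minP; apply: no_cross_minimal.
Qed.
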